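(* Suppose that the general assumptions (G1)--(G6) listed in the context hold. Let $\vartheta^\star$ and $\widehat{\vartheta}_N^\star$ denote the optimal values of problem (P) and of the SAA problem (P$_{\mathrm{SAA}}$) with sample size $N$, respectively, and for each $N\in\mathbb{N}$ let $u_N^*$ be a solution to (P$_{\mathrm{SAA}}$). Then, w.p.1, $\widehat{\vartheta}_N^\star \to \vartheta^\star$ as $N\to\infty$, and each weak$^*$ limit point of $(u_N^* )$ solves problem (P). (That is, for $P$-a.e. $\omega\in\Omega$, $\widehat{\vartheta}_N^\star(\omega)\to\vartheta^\star$ and each weak$^*$ limit point of $(u_N^*(\omega))$ solves (P); no measurability of $\omega\mapsto u_N^*(\omega)$ is required.)
   Context: Probabilistic setting: $(\Omega,\mathcal{F},P)$ is a complete probability space; $\Xi$ is a complete separable metric space with its Borel $\sigma$-algebra; $\xi\colon\Omega\to\Xi$ is a random element whose law $\mathbb{P}$ is assumed complete; $\xi^1,\xi^2,\ldots$ are independent $\Xi$-valued random elements on $(\Omega,\mathcal{F},P)$, each with law $\mathbb{P}$; $\mathbb{E}$ denotes expectation. ''W.p.1'' means for $P$-a.e. $\omega\in\Omega$; dependence on $\omega$ is often suppressed. General assumptions: (G1) $W$, $R$, $R_0$ are real separable Banach spaces with $R\subset R_0$, and $U$ is the dual of a real separable Banach space. (G2) $B\colon U\to W$ is linear and sequentially weakly$^*$-to-strongly continuous ($u_N\rightharpoonup^* u$ implies $Bu_N\to Bu$ in $W$). (G3) $\mathscr{J}\colon W\times\Xi\to[0,\infty)$ is random lower semicontinuous, i.e.,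 $\xi\mapsto\{(w,t)\in W\times\mathbb{R}\mid \mathscr{J}(w,\xi)\le t\}$ is a random closed set (a measurable closed-valued multifunction). (G4) $\mathscr{G}\colon W\times\Xi\to R_0$ is Carath\'eodory (continuous in the first argument, measurable in the second), $\mathscr{G}(Bu,\xi)\in R$ for all $(u,\xi)\in U\times\Xi$, and $\mathscr{G}\colon B(\mathrm{dom}(\psi))\times\Xi\to R$ is Carath\'eodory. Moreover, $K\subset R$ is a nonempty, closed, convex cone. (G5) $\psi\colon U\to[0,\infty]$ is proper, convex, and sequentially weakly$^*$ lower semicontinuous, with a bounded, weakly$^*$ sequentially closed domain $\mathrm{dom}(\psi)=\{u\in U\mid\psi(u)<\infty\}$. (G6) Problem (P) below has a feasible point with finite objective function value. Notation: $J(u,\xi):=\mathscr{J}(Bu,\xi)$, $G(u,\xi):=\mathscr{G}(Bu,\xi)$, $F\colon U\to[0,\infty)$, $F(u):=\mathbb{E}[J(u,\xi)]$, and $\widehat{F}_N(u):=\frac1N\sum_{i=1}^N J(u,\xi^i)$. Problem (P): $\min_{u\in U} F(u)+\psi(u)$ subject to $G(u,\xi)\in K$ for $\mathbb{P}$-a.e. $\xi\in\Xi$. Problem (P$_{\mathrm{SAA}}$): $\min_{u\in U}\widehat{F}_N(u)+\psi(u)$ subject to $G(u,\xi^i)\in K$, $i=1,\ldots,N$. *)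

(* Defs.v *)
From HB Require Import structures.
From mathcomp Require Import all_boot all_order all_algebra finmap.
From mathcomp Require Import all_classical all_reals all_analysis.

Set Implicit Arguments.
Unset Strict Implicit.
Unset Printing Implicit Defensive.

Import Order.TTheory GRing.Theory Num.Theory.
Import numFieldNormedType.Exports.

Local Open Scope classical_set_scope.
Local Open Scope ring_scope.

Definition separable_space (T : topologicalType) :=
  exists2 S : set T, countable S & dense S.

HB.structure Definition CompleteMetric (K : numDomainType) :=
  {T of Metric K T & CompletePseudoMetric K T}.
Notation completeMetricType := CompleteMetric.type.

Section dual.
Context (R : realType) (V : normedModType R).

Definition continuous_functional : {pred V -> R^o} :=
  [pred u : V -> R^o | `[< linear u /\ continuous u >]].

Lemma continuous_functional_submod_closed :
  submod_closed continuous_functional.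
Proof.
split=> [|a u v /asboolP[lu cu] /asboolP[lv cv]]; apply/asboolP; split.
- by move=> a x y; rewrite /= scaler0 addr0.
- exact: cst_continuous.
- move=> b x y; rewrite !fctE lu lv !scalerDr !scalerA (mulrC b a).
  by rewrite addrACA.
- move=> x; apply: cvgD; last exact: cv.
  by apply: cvgZl_tmp; exact: cu.
Qed.

HB.instance Definition _ := GRing.isSubmodClosed.Build _ _
  continuous_functional continuous_functional_submod_closed.

Record dual := Dual {
  dual_fun :> V -> R^o ;
  dual_funP : dual_fun \in continuous_functional }.

HB.instance Definition _ := [isSub for dual_fun].
HB.instance Definition _ := [Choice of dual by <:].
HB.instance Definition _ := [SubChoice_isSubLmodule of dual by <:].

Definition dual_norm (u : dual) : R :=
  sup [set `|u v| | v in [set v : V | `|v| <= 1]].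

Definition dual_bounded (A : set dual) :=
  exists M : R, forall u, A u -> dual_norm u <= M.

Definition weak_star := initial_topology (dual_fun : dual -> {ptws V -> R^o}).

HB.instance Definition _ := Topological.on weak_star.

Definition weak_star_cvg (u_ : nat -> dual) (u : dual) :=
  (u_ : nat -> weak_star) @ \oo --> (u : weak_star).

Definition weak_star_limit_point (u_ : nat -> dual) (u : dual) :=
  cluster ((u_ : nat -> weak_star) @ \oo) (u : weak_star).

Definition weak_star_seq_closed (A : set dual) :=
  forall (u_ : nat -> dual) (u : dual),
    (forall n, A (u_ n)) -> weak_star_cvg u_ u -> A u.

Definition weak_star_seq_lsc (f : dual -> \bar R) :=
  forall (u_ : nat -> dual) (u : dual),
    weak_star_cvg u_ u -> (f u <= limn_einf (f \o u_))%E.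

Definition weak_star_to_strong_seq_continuous (W : normedModType R)
    (B : dual -> W) :=
  forall (u_ : nat -> dual) (u : dual),
    weak_star_cvg u_ u -> B (u_ n) @[n --> \oo] --> B u.

End dual.

Arguments dual_fun {R V} d.

Lemma weak_star_cvgP (R : realType) (V : normedModType R)
    (u_ : nat -> dual V) (u : dual V) :
  weak_star_cvg u_ u <-> forall v : V, (u_ n v : R^o) @[n --> \oo] --> u v.
Proof.
rewrite /weak_star_cvg; split=> [uu|uu].
- pose f := @dual_fun R V : dual V -> {ptws V -> R^o}.
  have : {ptws, (f \o u_) @ \oo --> f u}.
    apply: cvg_comp; first exact: uu.
    exact: (@initial_continuous _ _ f).
  by move/pointwise_cvgP.
- pose f := @dual_fun R V : dual V -> {ptws V -> R^o}.
  have uf : {ptws, (f \o u_) @ \oo --> f u}.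
    by apply/pointwise_cvgP => v; exact: uu.
  move=> A; rewrite nbhsE => -[D [[C oC <-] Cu] DA].
  have uC : \forall n \near \oo, C (f (u_ n)).
    by apply: uf; exact: open_nbhs_nbhs.
  by near=> n; apply: DA; near: n.
Unshelve. all: by end_near. Qed.

Section convexity.
Context (R : realType) (E : lmodType R).

Definition effective_domain (f : E -> \bar R) : set E :=
  [set u | (f u < +oo)%E].

Definition proper_function (f : E -> \bar R) :=
  (forall u, f u != -oo%E) /\ effective_domain f !=set0.

Definition convex_efunction (f : E -> \bar R) :=
  forall (t : R) (u v : E), 0 < t < 1 ->
    (f (t *: u + (1 - t) *: v)%R <= t%:E * f u + (1 - t)%:E * f v)%E.

Definition is_cone (K : set E) :=
  forall (t : R) (x : E), 0 < t -> K x -> K (t *: x).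

End convexity.

Definition borel (T : ptopologicalType) := g_sigma_algebraType (@open T).

HB.instance Definition _ (T : ptopologicalType) := Measurable.on (borel T).

(* The completion under mu of the Borel sigma-algebra: the sigma-algebra
   generated by the Borel sets and the mu-negligible sets. It is the Borel
   sigma-algebra itself if mu is already complete on the Borel sets. *)
Definition completed_borel (T : ptopologicalType) (R : realType)
    (mu : set (borel T) -> \bar R) :=
  g_sigma_algebraType (measurable `|` mu.-negligible : set (set (borel T))).

HB.instance Definition _ (T : ptopologicalType) (R : realType)
  (mu : set (borel T) -> \bar R) := Measurable.on (completed_borel mu).

Lemma completed_borelE (R : realType) (T : ptopologicalType)
    (mu : {measure set (borel T) -> \bar R}) :
  measure_is_complete mu ->
  (measurable : set (set (completed_borel mu))) =
  (measurable : set (set (borel T))).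
Proof.
move=> h; rewrite /measurable/=.
have -> : (<<s @open T>> : set (set T)) `|` mu.-negligible = <<s @open T>>.
  by apply/seteqP; split=> A; [case=> //; exact: h | left].
by rewrite (sigma_algebra_id (smallest_sigma_algebra _ _)).
Qed.

Definition mutually_independent d d' (T : measurableType d)
    (T' : measurableType d') (R : realType) (P : probability T R)
    (X : nat -> {RV P >-> T'}) :=
  forall (I : {fset nat}) (A : nat -> set T'),
    (forall i, measurable (A i)) ->
    P (\bigcap_(i in [set` I]) (X i @^-1` A i)) =
    (\prod_(i <- I) P (X i @^-1` A i))%E.

Definition random_closed_set d (T : measurableType d) (X : topologicalType)
    (C : T -> set X) :=
  (forall t, closed (C t)) /\
  (forall O, open O -> measurable [set t | C t `&` O !=set0]).

Definition epigraph (R : realType) (W : Type) (f : W -> R) : set (W * R^o) :=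
  [set p | f p.1 <= p.2].

Definition random_lsc d (T : measurableType d) (R : realType)
    (W : topologicalType) (f : W -> T -> R) :=
  random_closed_set (fun t => epigraph (f ^~ t)).

Definition caratheodory_on d (T : measurableType d) (W : topologicalType)
    (Y : ptopologicalType) (D : set W) (g : W -> T -> Y) :=
  (forall t, {within D, continuous (g ^~ t)}) /\
  (forall w, D w -> measurable_fun setT (g w : T -> borel Y)).

Section minimization.
Context (R : realType) (E : Type) (feas : set E) (obj : E -> \bar R).

Definition optimal_value : \bar R := ereal_inf (obj @` feas).

Definition solves (u : E) :=
  feas u /\ (forall v, feas v -> (obj u <= obj v)%E).

End minimization.

(* The inclusion of the Banach space Y into Y0 is the linear injection iota;
   the sample points are numbered from 0, and the problem of size N uses those
   of index i < N. *)
Section problems.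
Context d (Omega : measurableType d) (R : realType) (P : probability Omega R).
Context (Xi : completeMetricType R).
Context (V W Y Y0 : completeNormedModType R).
Context (iota : Y -> Y0) (K : set Y).
Context (B : dual V -> W) (J : W -> Xi -> R) (G : W -> Xi -> Y0).
Context (psi : dual V -> \bar R).

Definition feasible (xi : {RV P >-> borel Xi}) : set (dual V) :=
  [set u | {ae distribution P xi, forall x, (iota @` K) (G (B u) x)}].

(* F u = E[J(u, xi)] is taken in [0, +oo]. *)
Definition objective (xi : {RV P >-> borel Xi}) (u : dual V) : \bar R :=
  ('E_P[fun omega => J (B u) (xi omega)] + psi u)%E.

Definition saa_feasible (sample : nat -> {RV P >-> borel Xi}) (N : nat)
    (omega : Omega) : set (dual V) :=
  [set u | forall i, (i < N)%N -> (iota @` K) (G (B u) (sample i omega))].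

Definition saa_objective (sample : nat -> {RV P >-> borel Xi}) (N : nat)
    (omega : Omega) (u : dual V) : \bar R :=
  ((N%:R^-1 * \sum_(i < N) J (B u) (sample i omega))%R%:E + psi u)%E.

End problems.

(* Main.v *)
From HB Require Import structures.
Require Import Defs.
From mathcomp Require Import all_boot all_order all_algebra finmap.
From mathcomp Require Import all_classical all_reals all_analysis measurable_realfun.
From mathcomp Require Import ring lra.

Set Implicit Arguments.
Unset Strict Implicit.
Unset Printing Implicit Defensive.

Import Order.TTheory GRing.Theory Num.Theory.
Import numFieldNormedType.Exports.

Local Open Scope classical_set_scope.
Local Open Scope ring_scope.

(** The sample average problems epi-converge almost surely, and the bounded,
weak-star sequentially compact domain of [psi] turns this into convergence of
the optimal values and of the solutions. Everything rests on the strong law of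
large numbers applied to countably many functions of the sample, so that a
single null set of outcomes has to be discarded.

Upper bound. Along a minimizing sequence of feasible points of the true problem
(countably many), almost surely every point is feasible for every sample problem,
and by [strong_law] its sample objective tends to its true objective. Hence the
limsup of the sample optimal values is at most the true optimal value.

Lower bound for the objective. For a ball [b] of a countable base of [W], the
infimum of [J] over [b] is measurable, because the epigraph of [J] is a random
closed set. Truncated at an integer, it is bounded, so its sample means converge.
If [B v_n] tends to [B u], then [B v_n] is eventually in each [b] around [B u],
so the sample means of [J (B v_n)] are asymptotically at least the expectation
of the truncated infimum. As [b] shrinks to [B u] and the truncation level grows,
this tends to [J (B u)] pointwise by lower semicontinuity, and Fatou's lemma
finishes ([limit_objective_le]).

Constraints. For a ball [b] and a tolerance, let [C] be the set of those [x] for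
which some point of a countable dense subset of [B (dom psi)] in [b] satisfies
the constraint at [x] up to the tolerance. Almost surely, if all sample points
lie in [C] then [C] has probability one, since the sample frequency of [C] tends to its
probability. If sample-feasible points [B v_n] tend to [B u], all sample points
lie in every such [C] with [b] around [B u]; so almost every [x] does, and by
continuity the constraint holds at [B u] for almost every [x]
([limit_feasible]).

Compactness. A dual-bounded sequence has a cluster point by Tychonoff's theorem
([bounded_ptws_cluster]), and separability of the predual lets a subsequence
converge weak-star to any given cluster point ([weak_star_subsequence]). Applied
to the sample solutions this gives the lower bound for the optimal values, and
applied to a given limit point it gives its optimality.

The strong law is proved for pairwise independent, identically distributed,
nonnegative integrable functions: a second moment estimate along the squares
handles bounded functions, and a truncation at [2 ^ n] along the dyadic integers
bounds the limsup of the means by twice the expectation in general. The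
latter, applied to the excess of [h] over a large constant, reduces the general
case to the bounded one. *)

(** * Summability and interpolation of averages *)

Section ae_summable.
Context d (T : measurableType d) (R : realType) (mu : {measure set T -> \bar R}).

(** The series of the [f n] has finite integral, hence is finite almost
everywhere. This replaces Chebyshev and Borel-Cantelli below. *)
Lemma ae_cvg0_of_summable (f : nat -> T -> R) (C : \bar R) :
  (forall n, measurable_fun setT (f n)) -> (forall n x, 0 <= f n x) ->
  (C < +oo)%E ->
  (forall n, (\sum_(i < n) \int[mu]_x (f i x)%:E <= C)%E) ->
  {ae mu, forall x, f n x @[n --> \oo] --> 0}.
Proof.
move=> mf f0 Coo fC.
have mfE n : measurable_fun setT (fun x => (f n x)%:E) by exact/measurable_EFinP.
pose S x := (\sum_(n <oo) (f n x)%:E)%E.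
have S0 x : (0 <= S x)%E by apply: nneseries_ge0 => n _ _; rewrite lee_fin.
have mS : measurable_fun setT S.
  by apply: ge0_emeasurable_sum => // n x _ _; rewrite lee_fin.
have IS : (\int[mu]_x S x <= C)%E.
  rewrite integral_nneseries//; last by move=> n x _; rewrite lee_fin.
  apply: lime_le.
    by apply: is_cvg_nneseries => n _ _; apply: integral_ge0 => x _; rewrite lee_fin.
  by apply: nearW => n; rewrite big_mkord.
have /integrable_ae : mu.-integrable setT S.
  apply/integrableP; split=> //.
  under eq_integral do rewrite gee0_abs//.
  exact: le_lt_trans Coo.
move=> /(_ measurableT); apply: filterS => x /(_ I).
rewrite ge0_fin_numE// => Sx.
apply: cvg_series_cvg_0.
have cS : cvgn (fun n => \sum_(0 <= i < n) (f i x)%:E)%E.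
  by apply: is_cvg_nneseries => n _ _; rewrite lee_fin.
have Sfin : S x \is a fin_num by rewrite ge0_fin_numE.
apply/cvg_ex; exists (fine (S x)).
have /fine_cvg : (\sum_(0 <= i < n) (f i x)%:E)%E @[n --> \oo] --> (fine (S x))%:E.
  by rewrite fineK.
by apply: cvg_trans; apply: near_eq_cvg; apply: nearW => n; rewrite /= sumEFin.
Qed.

End ae_summable.

Section finite_measure_integrable.
Context d (T : measurableType d) (R : realType) (P : probability T R).

Lemma bounded_measurable_integrable (f : T -> R) (M : R) :
  measurable_fun setT f -> (forall x, `|f x| <= M) ->
  P.-integrable setT (EFin \o f).
Proof.
move=> mf fM; apply: measurable_bounded_integrable => //.
  by rewrite -ge0_fin_numE// fin_num_measure.
exists M; split; first exact: num_real.
by move=> y My x _; rewrite /= (le_trans (fM x))// ltW.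
Qed.

End finite_measure_integrable.

Section interpolation.
Context (R : realType) (a : nat -> R).
Hypothesis a0 : forall i, 0 <= a i.
Let S n := \sum_(i < n) a i.

Lemma partial_sum_le m n : (m <= n)%N -> \sum_(i < m) a i <= \sum_(i < n) a i.
Proof.
by move=> mn; rewrite -(subnKC mn) big_split_ord/= lerDl sumr_ge0.
Qed.

(** Between two consecutive squares the partial sums of a nonnegative sequence
are squeezed, and the ratio of consecutive squares tends to one. *)
Lemma mean_cvg_of_squares (m : R) :
  ((n.+1 ^ 2)%:R^-1 * S (n.+1 ^ 2)) @[n --> \oo] --> m ->
  (n%:R^-1 * S n) @[n --> \oo] --> m.
Proof.
set u := (fun n => _) => um.
have h0 : @harmonic R n @[n --> \oo] --> (0:R) := cvg_harmonic.
have um1 : u n.+1 @[n --> \oo] --> m by rewrite (cvg_shiftS u).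
have h01 : @harmonic R n.+1 @[n --> \oo] --> (0:R) by rewrite (cvg_shiftS (@harmonic R)).
have up : u n.+1 * (1 + harmonic n) ^+ 2 @[n --> \oo] --> m.
  rewrite -[X in _ --> X]mulr1; apply: cvgM => //.
  rewrite -[X in _ --> X](expr1n _ 2) -[X in X ^+ _]addr0.
  rewrite expr2; under eq_fun do rewrite expr2.
  by apply: cvgM; apply: cvgD => //; exact: cvg_cst.
have lo : u n * (1 - harmonic n.+1) ^+ 2 @[n --> \oo] --> m.
  rewrite -[X in _ --> X]mulr1; apply: cvgM => //.
  rewrite -[X in _ --> X](expr1n _ 2) -[X in X ^+ _]subr0.
  rewrite expr2; under eq_fun do rewrite expr2.
  by apply: cvgM; apply: cvgB => //; exact: cvg_cst.
apply/cvgrPdist_le => e e0.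
move/cvgrPdist_le : up => /(_ e e0)[A _ hA].
move/cvgrPdist_le : lo => /(_ e e0)[B _ hB].
exists ((maxn A B).+2 ^ 2)%N => // N /= ABN.
have [p /andP[pN Np]] : exists p, (p.+1 ^ 2 <= N < p.+2 ^ 2)%N.
  have exq : exists q, (q.+1 ^ 2 <= N)%N.
    by exists 0%N; apply: leq_trans ABN.
  have qub q : (q.+1 ^ 2 <= N)%N -> (q <= N)%N.
    by move=> /(leq_trans _); apply; rewrite ltnW// -{1}(expn1 q.+1) leq_pexp2l.
  case: (ex_maxnP exq qub) => q qN qmax; exists q; rewrite qN /= ltnNge.
  by apply/negP => /qmax; rewrite ltnn.
have ABp : (maxn A B <= p)%N.
  rewrite leqNgt; apply/negP => pAB.
  have : (p.+2 ^ 2 <= (maxn A B).+2 ^ 2)%N by rewrite leq_exp2r// !ltnS ltnW.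
  by move=> /leq_trans/(_ ABN); rewrite leqNgt Np.
have {}hA := hA p (leq_trans (leq_maxl _ _) ABp).
have {}hB := hB p (leq_trans (leq_maxr _ _) ABp).
have N0 : (0 < N)%N by apply: leq_trans pN.
have NR : (0:R) < N%:R by rewrite ltr0n.
have q1 : (p.+1%:R : R) ^+ 2 <= N%:R by rewrite -natrX ler_nat.
have q2 : (N%:R:R) <= p.+2%:R ^+ 2 by rewrite -natrX ler_nat ltnW.
have p1R : (0:R) < p.+1%:R by rewrite ltr0n.
have p2R : (0:R) < p.+2%:R by rewrite ltr0n.
have up : N%:R^-1 * S N <= u p.+1 * (1 + harmonic p) ^+ 2.
  have -> : u p.+1 * (1 + harmonic p) ^+ 2 = (p.+1%:R ^+ 2)^-1 * S (p.+2 ^ 2)%N.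
    rewrite /u /harmonic /= natrX.
    have -> : 1 + p.+1%:R^-1 = p.+2%:R / p.+1%:R :> R.
      by rewrite -[p.+2]addn1 natrD mulrDl divff ?gt_eqF// mul1r.
    by field; rewrite !gt_eqF.
  apply: ler_pM => //.
  - by rewrite sumr_ge0.
  - by rewrite lef_pV2 ?posrE// exprn_gt0.
  - by apply: partial_sum_le; exact: ltnW.
have lo : u p * (1 - harmonic p.+1) ^+ 2 <= N%:R^-1 * S N.
  have -> : u p * (1 - harmonic p.+1) ^+ 2 = (p.+2%:R ^+ 2)^-1 * S (p.+1 ^ 2)%N.
    rewrite /u /harmonic /= natrX.
    have -> : 1 - p.+2%:R^-1 = p.+1%:R / p.+2%:R :> R.
      have -> : (p.+1%:R : R) = p.+2%:R - 1 by rewrite -[p.+2]addn1 natrD addrK.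
      by rewrite mulrBl divff ?gt_eqF// mul1r.
    by field; rewrite !gt_eqF.
  apply: ler_pM => //.
  - by rewrite sumr_ge0.
  - by rewrite lef_pV2 ?posrE// exprn_gt0.
  - exact: partial_sum_le.
move: hA hB; rewrite !ler_norml; lra.
Qed.

(** Between consecutive powers of two the ratio is two, so only a bound up to a
factor two survives. *)
Lemma mean_le_of_dyadic (c : R) :
  (\forall n \near \oo, (2 ^ n)%:R^-1 * S (2 ^ n)%N <= c) ->
  \forall n \near \oo, n%:R^-1 * S n <= 2 * c.
Proof.
move=> [A _ hA]; exists (2 ^ A)%N => // N /= AN.
have N0 : (0 < N)%N by apply: leq_trans AN; rewrite expn_gt0.
pose q := trunc_log 2 N.
have [q1 q2] : (2 ^ q <= N /\ N <= 2 ^ q.+1)%N.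
  by rewrite trunc_logP// ltnW// trunc_log_ltn.
have Aq : (A <= q.+1)%N by rewrite leqW// trunc_log_max.
apply: (@le_trans _ _ (2 * ((2 ^ q.+1)%:R^-1 * S (2 ^ q.+1)%N))); last first.
  by rewrite ler_pM2l// hA.
rewrite mulrA; apply: ler_pM.
- by rewrite invr_ge0.
- by rewrite sumr_ge0.
- rewrite expnS natrM invfM mulrA divff// mul1r lef_pV2 ?ler_nat//.
    by rewrite posrE ltr0n.
  by rewrite posrE ltr0n expn_gt0.
- exact: partial_sum_le.
Qed.

End interpolation.

(** The terms grow geometrically until [2 ^ i] exceeds [x] and decay geometrically
afterwards. The proof compares the partial sums with the explicit sequence [a],
which is at most [4 * x] and whose increments dominate the terms. *)
Lemma sum_dyadic_truncation (R : realType) (x : R) (n : nat) : 0 <= x ->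
  \sum_(i < n) (2 ^ i)%:R^-1 * Num.min x (2 ^ i)%:R ^+ 2 <= 4 * x.
Proof.
move=> x0.
pose a n : R := if (2 ^ n)%:R < x then (2 ^ n)%:R
                else 4 * x - 2 * (x ^+ 2 * (2 ^ n)%:R^-1).
suff : \sum_(i < n) (2 ^ i)%:R^-1 * Num.min x (2 ^ i)%:R ^+ 2 <= a n.
  move/le_trans; apply; rewrite /a; case: ifPn => [/ltW tx|_].
    by apply: le_trans tx _; lra.
  by rewrite gerBl mulr_ge0// mulr_ge0 ?sqr_ge0// invr_ge0.
elim: n => [|n ih].
  rewrite big_ord0 /a expn0 invr1 mulr1.
  case: ifPn => //; rewrite -leNgt => x1; nra.
rewrite big_ord_recr/=; apply: le_trans (lerD ih (lexx _)) _.
rewrite /a expnS natrM; set t : R := (2 ^ n)%:R.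
have t0 : 0 < t by rewrite ltr0n expn_gt0.
have [tx|xt] := ltP t x.
  have -> : t^-1 * t ^+ 2 = t by rewrite expr2 mulrA mulVf ?mul1r// gt_eqF.
  case: ifPn => [_|]; first by lra.
  rewrite -leNgt => x2t.
  rewrite -(ler_pM2r t0).
  have -> : (4 * x - 2 * (x ^+ 2 * (2 * t)^-1)) * t = 4 * x * t - x ^+ 2.
    by field; rewrite gt_eqF.
  nra.
rewrite ltNge (le_trans xt) /=; last by lra.
have -> : x ^+ 2 * (2 * t)^-1 = t^-1 * x ^+ 2 / 2 by field; rewrite gt_eqF.
by rewrite (mulrC (x ^+ 2) t^-1); lra.
Qed.

(** * The strong law of large numbers *)

Section strong_law_of_large_numbers.
Context d (Omega : measurableType d) d' (T' : measurableType d') (R : realType).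
Context (P : probability Omega R).
Context (X : nat -> {mfun Omega >-> T'}) (Z : {mfun Omega >-> T'}).
Hypothesis law : forall i (A : set T'), measurable A ->
  P (X i @^-1` A) = P (Z @^-1` A).
Hypothesis indep : forall i j (A B : set T'), i != j -> measurable A ->
  measurable B -> P ((X i @^-1` A) `&` (X j @^-1` B)) =
                  (P (X i @^-1` A) * P (X j @^-1` B))%E.

Lemma same_law_integral i (f : T' -> \bar R) : measurable_fun setT f ->
  (forall x, (0 <= f x)%E) -> (\int[P]_w f (X i w) = \int[P]_w f (Z w))%E.
Proof.
move=> mf f0.
rewrite -(@ge0_integral_distribution _ _ _ _ _ P (X i) f)//.
rewrite -(@ge0_integral_distribution _ _ _ _ _ P Z f)//.
by apply: eq_measure_integral => A mA _; exact: law.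
Qed.

(** The law of the pair [(X i, X j)] is the product measure, as both agree on
rectangles; then Tonelli applies. *)
Lemma indep_integral (i j : nat) (f g : T' -> R) : i != j ->
  measurable_fun setT f -> measurable_fun setT g ->
  (forall x, 0 <= f x) -> (forall x, 0 <= g x) ->
  (\int[P]_w (f (X i w) * g (X j w))%:E =
  \int[P]_w (f (Z w))%:E * \int[P]_w (g (Z w))%:E)%E.
Proof.
move=> ij mf mg f0 g0.
pose W w := (X i w, X j w).
have mW : measurable_fun setT W by exact: measurable_fun_pair.
pose W' : {mfun Omega >-> (T' * T')%type} :=
  HB.pack W (isMeasurableFun.Build _ _ _ _ W mW).
pose h (p : T' * T') := (f p.1 * g p.2)%:E.
have mh : measurable_fun setT h.
  apply/measurable_EFinP; apply: measurable_funM.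
    by apply: measurableT_comp => //; exact: measurable_fst.
  by apply: measurableT_comp => //; exact: measurable_snd.
have h0 p : (0 <= h p)%E by rewrite lee_fin mulr_ge0.
rewrite -[LHS](@ge0_integral_distribution _ _ _ _ _ P W' h)//.
transitivity (\int[(distribution P Z \x distribution P Z)%E]_p h p)%E.
  apply: eq_measure_integral => A mA _; apply/esym.
  apply: product_measure_unique => // B C mB mC.
  transitivity (P ((X i @^-1` B) `&` (X j @^-1` C))); first by [].
  by rewrite indep// !law.
rewrite fubini_tonelli1// /fubini_F/=.
have mEFin (k : T' -> R) : measurable_fun setT k ->
    measurable_fun setT (fun x => (k x)%:E) by move=> mk; exact/measurable_EFinP.
transitivity (\int[distribution P Z]_x
    ((f x)%:E * \int[distribution P Z]_y (g y)%:E))%E.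
  apply: eq_integral => x _; rewrite /h/=.
  under eq_integral do rewrite EFinM.
  by rewrite ge0_integralZl ?lee_fin//; [exact: mEFin|move=> y _; rewrite lee_fin].
rewrite ge0_integralZr//; last 3 first.
- exact: mEFin.
- by move=> y _; rewrite lee_fin.
- by apply: integral_ge0 => y _; rewrite lee_fin.
by rewrite !(@ge0_integral_distribution _ _ _ _ _ P Z (fun x => (_ x)%:E))//;
  by [exact: mEFin|move=> y; rewrite lee_fin].
Qed.

Definition sample_mean (g : T' -> R) (k : nat) (w : Omega) : R :=
  k%:R^-1 * \sum_(i < k) g (X i w).

Lemma measurable_sample_mean (g : T' -> R) k : measurable_fun setT g ->
  measurable_fun setT (sample_mean g k).
Proof.
move=> mg; apply: measurable_funM => //.
by apply: measurable_sum => i; exact: measurableT_comp.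
Qed.

Lemma sample_mean_ge0 (g : T' -> R) k w : (forall x, 0 <= g x) ->
  0 <= sample_mean g k w.
Proof. by move=> g0; rewrite mulr_ge0 ?invr_ge0// sumr_ge0. Qed.

(** Only the diagonal terms of the expanded square contribute to the variance.
The square of [S - k * m] is never expanded inside the integral: adding
[2 * (k * m) * S] on both sides keeps all integrands nonnegative. *)
Lemma sample_mean_variance (g : T' -> R) (m s : R) (k : nat) : (0 < k)%N ->
  measurable_fun setT g -> (forall x, 0 <= g x) ->
  (\int[P]_w (g (Z w))%:E = m%:E)%E -> (\int[P]_w (g (Z w) ^+ 2)%:E = s%:E)%E ->
  (\int[P]_w ((sample_mean g k w - m) ^+ 2)%:E <= (k%:R^-1 * s)%:E)%E.
Proof.
move=> k0 mg g0 gm gs.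
pose S w := \sum_(i < k) g (X i w).
have S0 w : 0 <= S w by rewrite sumr_ge0.
have mgX i : measurable_fun setT (fun w => g (X i w)) by exact: measurableT_comp.
have mS : measurable_fun setT S by apply: measurable_sum.
have mE (f : Omega -> R) : measurable_fun setT f ->
    measurable_fun setT (fun x => (f x)%:E) by move=> mf; exact/measurable_EFinP.
have m0 : 0 <= m.
  by rewrite -lee_fin -gm; apply: integral_ge0 => x _; rewrite lee_fin.
have s0 : 0 <= s.
  by rewrite -lee_fin -gs; apply: integral_ge0 => x _; rewrite lee_fin sqr_ge0.
have IS : (\int[P]_w (S w)%:E = (k%:R * m)%:E)%E.
  under eq_integral do rewrite -sumEFin.
  rewrite ge0_integral_sum//; last 2 first.
  - by move=> i; exact: mE.
  - by move=> i w _; rewrite lee_fin.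
  under eq_bigr => i _.
    rewrite (@same_law_integral i (fun x => (g x)%:E)); last 2 first.
    - exact/measurable_EFinP.
    - by move=> x; rewrite lee_fin.
    rewrite gm; over.
  by rewrite sumEFin sumr_const card_ord mulr_natl.
have IS2 : (\int[P]_w (S w ^+ 2)%:E <= (k%:R * s + (k%:R * m) ^+ 2)%:E)%E.
  have Sij w : (S w ^+ 2)%:E =
      (\sum_(i < k) \sum_(j < k) (g (X i w) * g (X j w))%:E)%E.
    rewrite expr2 /S big_distrlr/= -sumEFin; apply: eq_bigr => i _.
    by rewrite -sumEFin.
  under eq_integral do rewrite Sij.
  rewrite ge0_integral_sum//; last 2 first.
  - move=> i; apply: emeasurable_sum => j; apply: mE.
    exact: measurable_funM.
  - by move=> i w _; rewrite sume_ge0// => j _; rewrite lee_fin mulr_ge0.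
  apply: (@le_trans _ _ (\sum_(i < k) (s + k%:R * m ^+ 2)%:E)%E); last first.
    rewrite sumEFin sumr_const card_ord lee_fin -[leLHS]mulr_natl mulrDr.
    by rewrite exprMn mulrA expr2.
  apply: lee_sum => i _.
  rewrite ge0_integral_sum//; last 2 first.
  - by move=> j; apply: mE; exact: measurable_funM.
  - by move=> j w _; rewrite lee_fin mulr_ge0.
  have Iij j : (\int[P]_w (g (X i w) * g (X j w))%:E)%E =
      (if j == i then s else m ^+ 2)%:E.
    case: eqVneq => [->|ji].
      rewrite (@same_law_integral i (fun x => (g x * g x)%:E)) ?gs//.
      - by apply/measurable_EFinP; exact: measurable_funM.
      - by move=> x; rewrite lee_fin mulr_ge0.
    rewrite indep_integral ?gm//.
    by rewrite eq_sym.
  under eq_bigr do rewrite Iij.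
  rewrite sumEFin lee_fin (bigD1 i)//= eqxx lerD2l.
  apply: (@le_trans _ _ (\sum_(j < k) m ^+ 2)); last first.
    by rewrite sumr_const card_ord mulr_natl.
  rewrite big_mkcond; apply: ler_sum => j _.
  case: (boolP (j == i)) => [_|/negbTE ji] /=; first exact: sqr_ge0.
  by rewrite [X in if X then _ else _]ji.
have key : (\int[P]_w ((S w - k%:R * m) ^+ 2)%:E <= (k%:R * s)%:E)%E.
  set I := (X in (X <= _)%E).
  have m2 : measurable_fun setT (fun w => ((S w - k%:R * m) ^+ 2)%:E).
    by apply: mE; apply: measurable_funX; exact: measurable_funB.
  have : (I + (2 * (k%:R * m) * (k%:R * m))%:E =
          \int[P]_w (S w ^+ 2)%:E + ((k%:R * m) ^+ 2)%:E)%E.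
    have -> : ((2 * (k%:R * m) * (k%:R * m))%:E =
              \int[P]_w (2 * (k%:R * m) * S w)%:E)%E.
      under eq_integral do rewrite EFinM.
      rewrite ge0_integralZl ?IS ?lee_fin ?mulr_ge0// ?EFinM//.
      - exact: mE.
      - by move=> x _; rewrite lee_fin.
    have -> : (((k%:R * m) ^+ 2)%:E = \int[P]_w ((k%:R * m) ^+ 2)%:E)%E.
      rewrite integral_cst//; transitivity (((k%:R * m) ^+ 2)%:E * 1)%E.
        by rewrite mule1.
      by congr (_ * _)%E; rewrite -(@probability_setT _ _ _ P).
    rewrite /I -!ge0_integralD//.
    - by apply: eq_integral => w _; rewrite -!EFinD; congr EFin; ring.
    - by move=> w _; rewrite lee_fin sqr_ge0.
    - by apply: mE; exact: measurable_funX.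
    - by move=> w _; rewrite lee_fin sqr_ge0.
    - by move=> w _; rewrite lee_fin sqr_ge0.
    - by move=> w _; rewrite lee_fin !mulr_ge0.
    - by apply: mE; exact: measurable_funM.
  move=> h; rewrite -(@leeD2rE _ (2 * (k%:R * m) * (k%:R * m))%:E)// h.
  apply: le_trans (leeD2r _ IS2) _.
  by rewrite -!EFinD lee_fin; lra.
have -> : (\int[P]_w ((sample_mean g k w - m) ^+ 2)%:E =
    ((k%:R^-1) ^+ 2)%:E * \int[P]_w ((S w - k%:R * m) ^+ 2)%:E)%E.
  rewrite -ge0_integralZl ?lee_fin ?sqr_ge0//.
  - apply: eq_integral => w _; rewrite -EFinM; congr EFin.
    rewrite -exprMn mulrBr mulrA mulVf ?mul1r//.
    by rewrite pnatr_eq0 -lt0n.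
  - by apply: mE; apply: measurable_funX; exact: measurable_funB.
  - by move=> w _; rewrite lee_fin sqr_ge0.
apply: le_trans (lee_wpmul2l _ key) _; first by rewrite lee_fin sqr_ge0.
rewrite -EFinM lee_fin expr2 mulrA -(mulrA _ _ k%:R) mulVf ?mulr1//.
by rewrite pnatr_eq0 -lt0n.
Qed.

Lemma bounded_mean (g : T' -> R) (M : R) : measurable_fun setT g ->
  (forall x, 0 <= g x <= M) ->
  exists2 m, 0 <= m & (\int[P]_w (g (Z w))%:E = m%:E)%E.
Proof.
move=> mg gM.
have : P.-integrable setT (EFin \o (g \o Z)).
  apply: (@bounded_measurable_integrable _ _ _ _ _ M).
    exact: measurableT_comp.
  by move=> w /=; rewrite ger0_norm; case/andP: (gM (Z w)).
move=> /integrable_fin_num /fineK => /(_ measurableT) Im.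
exists (fine (\int[P]_w (g (Z w))%:E)); last by rewrite Im.
by rewrite fine_ge0// integral_ge0// => w _; rewrite lee_fin; case/andP: (gM (Z w)).
Qed.

Lemma strong_law_bounded (g : T' -> R) (M m : R) : measurable_fun setT g ->
  (forall x, 0 <= g x <= M) -> (\int[P]_w (g (Z w))%:E = m%:E)%E ->
  {ae P, forall w, sample_mean g n w @[n --> \oo] --> m}.
Proof.
move=> mg gM gm.
have g0 x : 0 <= g x by case/andP: (gM x).
have [s s0 gs] : exists2 s, 0 <= s & (\int[P]_w (g (Z w) ^+ 2)%:E = s%:E)%E.
  apply: (@bounded_mean (fun x => g x ^+ 2) (M ^+ 2)).
    exact: measurable_funX.
  by move=> x; case/andP: (gM x) => ? ?; rewrite sqr_ge0 ler_pXn2r ?nnegrE ?(le_trans (g0 x)).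
pose f n w := (sample_mean g (n.+1 ^ 2) w - m) ^+ 2.
have mf n : measurable_fun setT (f n).
  apply: measurable_funX; apply: measurable_funB => //.
  exact: measurable_sample_mean.
have : {ae P, forall w, f n w @[n --> \oo] --> 0}.
  apply: (@ae_cvg0_of_summable _ _ _ P f (2 * s)%:E) => //.
    by move=> n w; exact: sqr_ge0.
  by rewrite ltry.
  move=> n.
  apply: (@le_trans _ _ (\sum_(i < n) ((i.+1 ^ 2)%:R^-1 * s)%:E)%E).
    apply: lee_sum => i _.
    by apply: sample_mean_variance => //; rewrite expn_gt0.
  rewrite sumEFin -mulr_suml lee_fin ler_wpM2r//.
  (* For n = 0 the right-hand side is 2, as 0^-1 = 0 by convention. *)
  suff : \sum_(i < n) (i.+1 ^ 2)%:R^-1 <= 2 - n%:R^-1 :> R.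
    by move/le_trans; apply; rewrite gerBl invr_ge0.
  elim: n => [|n ih]; first by rewrite big_ord0 invr0; lra.
  rewrite big_ord_recr/=; case: n ih => [_|n ih].
    by rewrite big_ord0 exp1n !invr1; lra.
  apply: le_trans (lerD ih (lexx _)) _.
  have a0 : (0:R) < n.+1%:R by rewrite ltr0n.
  rewrite natrX; have -> : (n.+2%:R : R) = n.+1%:R + 1 by rewrite -[n.+2]addn1 natrD.
  move: (n.+1%:R : R) a0 => a a0.
  rewrite -subr_ge0.
  have -> : 2 - (a + 1)^-1 - (2 - a^-1 + ((a + 1) ^+ 2)^-1) = (a * (a + 1) ^+ 2)^-1.
    by field; rewrite !gt_eqF ?addr_gt0.
  by rewrite invr_ge0 mulr_ge0 ?sqr_ge0// ltW.
apply: filterS => w fw.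
apply: (@mean_cvg_of_squares _ (fun i => g (X i w))) => //.
apply/cvgrPdist_lt => e e0.
have e2 : 0 < e ^+ 2 by rewrite exprn_gt0.
move/cvgrPdist_lt : fw => /(_ _ e2); apply: filterS => n.
rewrite sub0r normrN ger0_norm ?sqr_ge0// distrC.
rewrite /f -real_normK ?num_real// ltr_pXn2r// nnegrE//.
exact: ltW.
Qed.

(** Among the first [2 ^ n] sample points, compare [h] with its truncation [g n]
at [t n = 2 ^ n]. Let [f n] be the squared deviation of the mean of [g n] plus
the number of sample points at which [h] exceeds [t n]. Each part has
expectation at most that of [(t n)^-1 * g n (Z w) ^+ 2], and these are summable by
[sum_dyadic_truncation]. So [f n] tends to zero: eventually the truncation is
invisible, because the number of exceedances is an integer, and the mean is close
to a number that is at most [m]. *)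
Lemma eventually_mean_le (h : T' -> R) (m : R) : measurable_fun setT h ->
  (forall x, 0 <= h x) -> (\int[P]_w (h (Z w))%:E = m%:E)%E ->
  {ae P, forall w, forall e, 0 < e ->
    \forall n \near \oo, sample_mean h n w <= 2 * m + e}.
Proof.
move=> mh h0 hm.
pose t n : R := (2 ^ n)%:R.
have t0 n : 0 < t n by rewrite ltr0n expn_gt0.
pose g n x := Num.min (h x) (t n).
have mg n : measurable_fun setT (g n) by exact: measurable_minr.
have g0 n x : 0 <= g n x by rewrite le_min h0 ltW.
have gt n x : g n x <= t n by rewrite ge_min lexx orbT.
have gh n x : g n x <= h x by rewrite ge_min lexx.
have /choice[mm mmE] : forall n, exists mn, 0 <= mn /\
    (\int[P]_w (g n (Z w))%:E = mn%:E)%E.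
  move=> n; have [|mn ? ?] := @bounded_mean (g n) (t n) (mg n); last by exists mn.
  by move=> x; rewrite g0 gt.
have /choice[ss ssE] : forall n, exists sn, 0 <= sn /\
    (\int[P]_w (g n (Z w) ^+ 2)%:E = sn%:E)%E.
  move=> n.
  have [||sn ? ?] := @bounded_mean (fun x => g n x ^+ 2) (t n ^+ 2).
  - exact: measurable_funX.
  - by move=> x; rewrite sqr_ge0/= ler_pXn2r ?gt//; rewrite nnegrE// ltW.
  - by exists sn.
have mEFin d1 (U : measurableType d1) (k : U -> R) : measurable_fun setT k ->
    measurable_fun setT (fun x => (k x)%:E) by move=> mk; exact/measurable_EFinP.
have mZ (k : T' -> R) : measurable_fun setT k ->
    measurable_fun setT (fun w => (k (Z w))%:E).
  by move=> mk; apply: mEFin; exact: measurableT_comp.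
have mmm n : mm n <= m.
  rewrite -lee_fin -(mmE n).2 -hm; apply: ge0_le_integral => //.
  - by move=> w _; rewrite lee_fin.
  - exact: (mZ (g n)).
  - exact: (mZ h).
  - by move=> w _; rewrite lee_fin.
pose A n := h @^-1` `]t n, +oo[.
have mA n : measurable (A n) by rewrite -[A n]setTI; exact: mh.
pose b n : T' -> R := \1_(A n).
have mb n : measurable_fun setT (b n) by exact: measurable_indic.
have b0 n x : 0 <= b n x by rewrite /b indicE.
have bg n x : t n * b n x <= (t n)^-1 * g n x ^+ 2.
  rewrite /b indicE; case: (boolP (x \in A n)) => [|_]; last first.
    by rewrite mulr0 mulr_ge0 ?sqr_ge0// invr_ge0 ltW.
  rewrite inE /A /= in_itv/= andbT => thx.
  have -> : g n x = t n by rewrite /g min_r// ltW.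
  by rewrite mulr1 expr2 mulrA mulVf ?mul1r// gt_eqF.
pose f n w := (sample_mean (g n) (2 ^ n) w - mm n) ^+ 2 +
              \sum_(i < 2 ^ n) b n (X i w).
have mf1 n : measurable_fun setT (fun w => (sample_mean (g n) (2 ^ n) w - mm n) ^+ 2).
  apply: measurable_funX; apply: measurable_funB => //.
  exact: measurable_sample_mean.
have mf2 n : measurable_fun setT (fun w => \sum_(i < 2 ^ n) b n (X i w)).
  by apply: measurable_sum => i; exact: measurableT_comp.
have : {ae P, forall w, f n w @[n --> \oo] --> 0}.
  apply: (@ae_cvg0_of_summable _ _ _ P f (8 * m)%:E).
  - by move=> n; exact: measurable_funD.
  - by move=> n w; rewrite addr_ge0 ?sqr_ge0// sumr_ge0.
  - by rewrite ltry.
  move=> n.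
  have Ifn i : (\int[P]_x (f i x)%:E <=
                \int[P]_w (2 * ((t i)^-1 * g i (Z w) ^+ 2))%:E)%E.
    rewrite /f; under eq_integral do rewrite EFinD.
    rewrite ge0_integralD//; last 4 first.
    - by move=> w _; rewrite lee_fin sqr_ge0.
    - exact: mEFin.
    - by move=> w _; rewrite lee_fin sumr_ge0.
    - exact: mEFin.
    have -> : (\int[P]_w (2 * ((t i)^-1 * g i (Z w) ^+ 2))%:E =
        ((t i)^-1 * ss i)%:E + \int[P]_w ((t i)^-1 * g i (Z w) ^+ 2)%:E)%E.
      have -> : (((t i)^-1 * ss i)%:E = \int[P]_w ((t i)^-1 * g i (Z w) ^+ 2)%:E)%E.
        rewrite EFinM -(ssE i).2 -ge0_integralZl ?lee_fin ?invr_ge0 ?(ltW (t0 _))//.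
        - by apply: (mZ (fun x => g i x ^+ 2)); exact: measurable_funX.
        - by move=> w _; rewrite lee_fin sqr_ge0.
      have mti : measurable_fun setT (fun w => ((t i)^-1 * g i (Z w) ^+ 2)%:E).
        apply: (mZ (fun x => (t i)^-1 * g i x ^+ 2)); apply: measurable_funM => //.
        exact: measurable_funX.
      have ti0 w : (0 <= ((t i)^-1 * g i (Z w) ^+ 2)%:E)%E.
        by rewrite lee_fin mulr_ge0 ?sqr_ge0// invr_ge0 ltW.
      rewrite -ge0_integralD//.
      by apply: eq_integral => w _; rewrite -EFinD; congr EFin; ring.
    apply: leeD.
      by apply: sample_mean_variance; rewrite ?expn_gt0//;
        [case: (mmE i)|case: (ssE i)].
    have [|beta _ Ib] := @bounded_mean (b i) 1 (mb i).
      by move=> x; rewrite b0 /b indicE lern1; case: (_ \in _).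
    under eq_integral do rewrite -sumEFin.
    rewrite ge0_integral_sum//; last 2 first.
    - by move=> j; apply: mEFin; exact: measurableT_comp.
    - by move=> j w _; rewrite lee_fin.
    under eq_bigr => j _.
      rewrite (@same_law_integral j (fun x => (b i x)%:E)); last 2 first.
      - exact: mEFin.
      - by move=> x; rewrite lee_fin.
      rewrite Ib; over.
    rewrite sumEFin sumr_const card_ord -mulr_natl EFinM -Ib.
    rewrite -ge0_integralZl//; last 2 first.
    - exact: (mZ (b i)).
    - by move=> w _; rewrite lee_fin.
    apply: ge0_le_integral => //.
    - by move=> w _; rewrite -EFinM lee_fin mulr_ge0.
    - by apply: mEFin; apply: measurable_funM => //; exact: measurableT_comp.
    - apply: (mZ (fun x => (t i)^-1 * g i x ^+ 2)); apply: measurable_funM => //.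
      exact: measurable_funX.
    - by move=> w _; rewrite -EFinM lee_fin bg.
  apply: (@le_trans _ _ (\sum_(i < n) \int[P]_w (2 * ((t i)^-1 * g i (Z w) ^+ 2))%:E)%E).
    by apply: lee_sum => i _.
  rewrite -ge0_integral_sum//; last 2 first.
  - move=> i; apply: (mZ (fun x => 2 * ((t i)^-1 * g i x ^+ 2))).
    by do 2 apply: measurable_funM => //; exact: measurable_funX.
  - by move=> i w _; rewrite lee_fin !mulr_ge0 ?sqr_ge0// invr_ge0 ltW.
  have -> : ((8 * m)%:E = \int[P]_w (8 * h (Z w))%:E)%E.
    rewrite EFinM -hm -ge0_integralZl//.
    - exact: (mZ h).
    - by move=> w _; rewrite lee_fin.
  apply: ge0_le_integral => //.
  - by move=> w _; apply: sume_ge0 => i _; rewrite lee_fin !mulr_ge0 ?sqr_ge0// invr_ge0 ltW.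
  - apply: emeasurable_sum => i; apply: (mZ (fun x => 2 * ((t i)^-1 * g i x ^+ 2))).
    by do 2 apply: measurable_funM => //; exact: measurable_funX.
  - by apply: (mZ (fun x => 8 * h x)); exact: measurable_funM.
  move=> w _; rewrite sumEFin lee_fin -mulr_sumr.
  have := sum_dyadic_truncation n (h0 (Z w)).
  by rewrite -/t /g /t; lra.
apply: filterS => w fw e e0.
have -> : 2 * m + e = 2 * (m + e / 2) by lra.
apply: (@mean_le_of_dyadic _ (fun i => h (X i w))) => //.
have e2 : 0 < e / 2 by rewrite divr_gt0.
have me0 : 0 < Num.min 1 ((e / 2) ^+ 2) by rewrite lt_min ltr01 exprn_gt0.
move/cvgrPdist_lt : fw => /(_ _ me0); apply: filterS => n.
have s0 : 0 <= \sum_(i < 2 ^ n) b n (X i w) by rewrite sumr_ge0.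
rewrite sub0r normrN ger0_norm ?addr_ge0 ?sqr_ge0// lt_min => /andP[f1 f2].
have hX (i : 'I_(2 ^ n)) : g n (X i w) = h (X i w).
  rewrite /g; apply: min_l; rewrite leNgt; apply/negP => thx.
  have : 1 <= \sum_(i < 2 ^ n) b n (X i w).
    rewrite (bigD1 i)//= {1}/b indicE mem_set; last by rewrite /A/= in_itv/= thx.
    by rewrite lerDl sumr_ge0.
  by rewrite leNgt; move: f1; rewrite /f; have := sqr_ge0 (sample_mean (g n) (2 ^ n) w - mm n); lra.
have -> : (2 ^ n)%:R^-1 * \sum_(i < 2 ^ n) h (X i w) = sample_mean (g n) (2 ^ n) w.
  by congr (_ * _); apply: eq_bigr => i _; rewrite hX.
have : `|sample_mean (g n) (2 ^ n) w - mm n| < e / 2.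
  rewrite -(ltr_pXn2r (n := 2))// ?nnegrE ?(ltW e2)// real_normK ?num_real//.
  by move: f2; rewrite /f; lra.
by rewrite ltr_norml; move=> /andP[_]; have := mmm n; lra.
Qed.

(** Split [h] at a level [M]. The mean of the bounded part converges to [a M], and
the mean of the excess is asymptotically at most [2 * (m - a M)], which is small
for large [M] by monotone convergence. *)
Theorem strong_law (h : T' -> R) (m : R) : measurable_fun setT h ->
  (forall x, 0 <= h x) -> (\int[P]_w (h (Z w))%:E = m%:E)%E ->
  {ae P, forall w, sample_mean h n w @[n --> \oo] --> m}.
Proof.
move=> mh h0 hm.
pose lo (M : nat) x := Num.min (h x) M%:R.
pose hi (M : nat) x := h x - lo M x.
have mlo M : measurable_fun setT (lo M) by exact: measurable_minr.
have mhi M : measurable_fun setT (hi M) by exact: measurable_funB.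
have lo0 M x : 0 <= lo M x by rewrite le_min h0 /=.
have hi0 M x : 0 <= hi M x by rewrite subr_ge0 ge_min lexx.
have loM M x : 0 <= lo M x <= M%:R by rewrite lo0 ge_min lexx orbT.
have mEZ (k : T' -> R) : measurable_fun setT k ->
    measurable_fun setT (fun w => (k (Z w))%:E).
  by move=> mk; apply/measurable_EFinP; exact: measurableT_comp.
have /choice[a aE] : forall M, exists a, (\int[P]_w (lo M (Z w))%:E = a%:E)%E.
  by move=> M; have [a _ aE] := bounded_mean (mlo M) (loM M); exists a.
have hiE M : (\int[P]_w (hi M (Z w))%:E = (m - a M)%:E)%E.
  have : (\int[P]_w (hi M (Z w))%:E + (a M)%:E = m%:E)%E.
    rewrite -aE -ge0_integralD//.
    - by rewrite -hm; apply: eq_integral => w _; rewrite -EFinD subrK.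
    - by move=> w _; rewrite lee_fin.
    - exact: mEZ.
    - by move=> w _; rewrite lee_fin.
    - exact: mEZ.
  by move=> E; rewrite EFinB -E addeK.
have am : a M @[M --> \oo] --> m.
  have : (\int[P]_w (lo M (Z w))%:E)%E @[M --> \oo] --> (\int[P]_w (h (Z w))%:E)%E.
    rewrite (_ : (fun w => (h (Z w))%:E) = (fun w => limn (fun M => (lo M (Z w))%:E))).
      apply: (@cvg_monotone_convergence _ _ _ P setT measurableT
        (fun M w => (lo M (Z w))%:E)) => //.
      - by move=> M; exact: mEZ.
      - by move=> M w _; rewrite lee_fin.
      - by move=> w _ M N MN; rewrite lee_fin le_min !ge_min lexx/= ler_nat MN orbT.
    apply/funext => w; apply/esym/cvg_lim => //.
    apply: cvg_near_cst; exists (Num.truncn (h (Z w))).+1 => // M /= hM.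
    congr EFin; apply: min_l; apply/ltW; apply: lt_le_trans (truncnS_gt _) _.
    by rewrite ler_nat.
  by rewrite hm (_ : (fun M => _) = EFin \o a) ?funeqE//; move/fine_cvg.
have : {ae P, forall w, (forall M, sample_mean (lo M) n w @[n --> \oo] --> a M) /\
   (forall M e, 0 < e -> \forall n \near \oo,
      sample_mean (hi M) n w <= 2 * (m - a M) + e)}.
  have A1 : {ae P, forall w, forall M, sample_mean (lo M) n w @[n --> \oo] --> a M}.
    by apply/ae_foralln => M; exact: (strong_law_bounded (mlo M) (loM M)).
  have A2 : {ae P, forall w, forall M e, 0 < e -> \forall n \near \oo,
      sample_mean (hi M) n w <= 2 * (m - a M) + e}.
    by apply/ae_foralln => M; exact: eventually_mean_le.
  by apply: filterS2 A1 A2 => w.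
apply: filterS => w [wlo whi].
apply/cvgrPdist_le => e e0.
have e4 : 0 < e / 4 by rewrite divr_gt0.
move/cvgrPdist_le : am => /(_ _ e4)[M _ /(_ M (leqnn _))] aM.
have /cvgrPdist_le/(_ _ e4) := wlo M.
apply: filterS2 (whi M _ e4) => n hin lon.
have -> : sample_mean h n w = sample_mean (lo M) n w + sample_mean (hi M) n w.
  rewrite /sample_mean -mulrDr -big_split/=; congr (_ * _).
  by apply: eq_bigr => i _; rewrite addrC subrK.
have := sample_mean_ge0 n w (hi0 M).
move: hin lon aM; rewrite !ler_norml; lra.
Qed.

(** The sample frequency of [C] is constantly one and tends to the probability
of [C]. *)
Lemma ae_all_samples_in (C : set T') : measurable C ->
  {ae P, forall w, (forall i, C (X i w)) -> P (Z @^-1` C) = 1%E}.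
Proof.
move=> mC; have mZC : measurable (Z @^-1` C) by rewrite -[_ @^-1` _]setTI; exact: measurable_funPT.
pose p := fine (P (Z @^-1` C)).
have pE : P (Z @^-1` C) = p%:E by rewrite fineK// fin_num_measure.
have := @strong_law \1_C p.
have Ip : (\int[P]_w (\1_C (Z w))%:E = p%:E)%E.
  rewrite -pE; transitivity (\int[P]_w (\1_(Z @^-1` C) w)%:E)%E => //.
  by rewrite integral_indic// setIT.
have C0 x : 0 <= \1_C x :> R by rewrite indicE.
move=> /(_ (measurable_indic mC) C0 Ip); apply: filterS => w wp wC.
have w1 : sample_mean \1_C n w @[n --> \oo] --> (1 : R).
  apply: cvg_near_cst; exists 1%N => // n /= n0.
  rewrite /sample_mean (eq_bigr (fun=> 1)); last first.
    by move=> i _; rewrite indicE mem_set.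
  by rewrite sumr_const card_ord mulVf// pnatr_eq0 -lt0n.
by rewrite pE (cvg_unique _ wp w1).
Qed.
End strong_law_of_large_numbers.

(** * Random elements of the completed Borel space *)

Lemma measure_eq_mod_null d (T : measurableType d) (R : realType)
    (mu : {measure set T -> \bar R}) (E F N : set T) :
  measurable E -> measurable F -> measurable N -> mu N = 0%E ->
  E `<=` F `|` N -> F `<=` E `|` N -> mu E = mu F.
Proof.
move=> mE mF mN N0 EF FE; apply/eqP; rewrite eq_le.
have h (A B : set T) : measurable A -> measurable B -> A `<=` B `|` N ->
    (mu A <= mu B)%E.
  move=> mA mB AB; have mBN : measurable (B `|` N) by exact: measurableU.
  apply: le_trans (le_measure _ _ _ AB) _; rewrite ?inE//.
  by apply: le_trans (measureU2 _ mB mN) _; move: N0; rewrite /= => ->; rewrite adde0.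
by rewrite !h.
Qed.

Section completion.
Context (T : ptopologicalType) (R : realType).

(** The sets that are Borel up to a null set form a sigma-algebra containing the
Borel sets and the negligible sets. This transfers laws and independence from the
Borel sigma-algebra to its completion. *)
Lemma completed_borel_approx (mu : {measure set (borel T) -> \bar R})
    (A : set (completed_borel mu)) : measurable A ->
  exists C N : set (borel T), [/\ measurable C, measurable N, mu N = 0%E,
    A `<=` C `|` N & C `<=` A `|` N].
Proof.
pose S : set (set T) := [set A | exists C N : set (borel T),
  [/\ measurable C, measurable N, mu N = 0%E, A `<=` C `|` N & C `<=` A `|` N]].
suff : <<s measurable `|` mu.-negligible >> `<=` S by apply.
apply: smallest_sub; last first.
  move=> B [mB|[N [mN N0 BN]]].
    by exists B, set0; split => //; rewrite setU0.
  by exists set0, N; split => //; rewrite set0U.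
split.
- by exists set0, set0; split => //; rewrite setU0.
- move=> B [C [N [mC mN N0 BC CB]]]; exists (~` C), N; split => //.
  + exact: measurableC.
  + move=> x [_ nBx]; have [Nx|nNx] := pselect (N x); [by right|left => Cx].
    by case: (CB _ Cx).
  + move=> x nCx; have [Nx|nNx] := pselect (N x); [by right|left; split => // Bx].
    by case: (BC _ Bx).
- move=> F /choice[C /choice[N FCN]].
  exists (\bigcup_i C i), (\bigcup_i N i); split.
  + by apply: bigcup_measurable => i _; case: (FCN i).
  + by apply: bigcup_measurable => i _; case: (FCN i).
  + have mN i : measurable (N i) by case: (FCN i).
    apply/eqP; rewrite eq_le measure_ge0 andbT.
    have := measure_sigma_subadditive mu mN (bigcup_measurable (fun i _ => mN i))
      (@subset_refl _ _).
    by move=> /le_trans; apply; rewrite eseries0// => i _ _; case: (FCN i).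
  + move=> x [i _ Fx]; case: (FCN i) => _ _ _ /(_ x Fx) [Cx|Nx] _.
      by left; exists i.
    by right; exists i.
  + move=> x [i _ Cx]; case: (FCN i) => _ _ _ _ /(_ x Cx) [Fx|Nx].
      by left; exists i.
    by right; exists i.
Qed.

Context d (Omega : measurableType d) (P : probability Omega R).
Hypothesis P_complete : measure_is_complete P.
Context (xi : {RV P >-> borel T}).
Local Notation cT := (completed_borel (distribution P xi)).

(** The preimage of a negligible set is contained in a null event, hence is an
event by completeness of [P]. *)
Lemma completed_measurable (X : {RV P >-> borel T}) :
  (forall A : set (borel T), measurable A ->
    distribution P X A = distribution P xi A) ->
  measurable_fun setT (X : Omega -> cT).
Proof.
move=> law.
apply: (measurability (measurable `|` (distribution P xi).-negligible
   : set (set cT))) => //.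
move=> _ [B [mB|[N [mN N0 BN]]] <-]; rewrite setTI.
  by rewrite -[_ @^-1` _]setTI; exact: (@measurable_funPT _ _ _ _ X).
apply: P_complete; exists (X @^-1` N); split.
- by rewrite -[_ @^-1` _]setTI; exact: (@measurable_funPT _ _ _ _ X).
- by rewrite -N0 -law.
- by move=> w; exact: BN.
Qed.

Definition completed_rv (X : {RV P >-> borel T}) (law : forall A : set (borel T),
    measurable A -> distribution P X A = distribution P xi A) :
    {mfun Omega >-> cT} :=
  HB.pack (X : Omega -> cT)
    (isMeasurableFun.Build _ _ _ _ (X : Omega -> cT) (completed_measurable law)).

Lemma measurable_preimage_borel (X : {RV P >-> borel T}) (A : set (borel T)) :
  measurable A -> measurable (X @^-1` A).
Proof. by move=> mA; rewrite -[_ @^-1` _]setTI; exact: (@measurable_funPT _ _ _ _ X). Qed.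

Lemma completed_law (X : {RV P >-> borel T}) (law : forall A : set (borel T),
    measurable A -> distribution P X A = distribution P xi A) (A : set cT) :
  measurable A -> P (X @^-1` A) = P (xi @^-1` A).
Proof.
move=> mA; have [C [N [mC mN N0 AC CA]]] := completed_borel_approx mA.
have h (Y : {RV P >-> borel T}) : (forall A : set (borel T),
    measurable A -> distribution P Y A = distribution P xi A) ->
    P (Y @^-1` A) = P (xi @^-1` C).
  move=> lawY; rewrite -[RHS](lawY C mC).
  apply: (@measure_eq_mod_null _ _ _ P _ _ (Y @^-1` N)).
  - by rewrite -[_ @^-1` _]setTI; exact: (completed_measurable lawY).
  - exact: measurable_preimage_borel.
  - exact: measurable_preimage_borel.
  - exact: etrans (lawY _ mN) N0.
  - by move=> w; exact: AC.
  - by move=> w; exact: CA.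
by rewrite !h.
Qed.

Lemma completed_null_negligible (A : set cT) : measurable A ->
  P (xi @^-1` A) = 0%E -> (distribution P xi).-negligible A.
Proof.
move=> mA A0; have [C [N [mC mN N0 AC CA]]] := completed_borel_approx mA.
exists (C `|` N); split => //; first exact: measurableU.
apply/eqP; rewrite eq_le measure_ge0 andbT.
apply: le_trans (measureU2 _ mC mN) _.
suff C0 : distribution P xi C = 0%E.
  by rewrite -[leRHS]adde0; apply: leeD; rewrite le_eqVlt; apply/orP; left; apply/eqP.
rewrite -A0; apply: (@measure_eq_mod_null _ _ _ P _ _ (xi @^-1` N)) => //.
- exact: measurable_preimage_borel.
- by rewrite -[_ @^-1` _]setTI; exact: (completed_measurable (fun _ _ => erefl)).
- exact: measurable_preimage_borel.
- by move=> w; exact: CA.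
- by move=> w; exact: AC.
Qed.

Lemma completed_independent (X : nat -> {RV P >-> borel T}) :
  mutually_independent X ->
  (forall i (A : set (borel T)), measurable A ->
    distribution P (X i) A = distribution P xi A) ->
  forall i j (A B : set cT), i != j -> measurable A -> measurable B ->
  P ((X i @^-1` A) `&` (X j @^-1` B)) =
  (P (X i @^-1` A) * P (X j @^-1` B))%E.
Proof.
move=> ind law i j A B ij mA mB.
have [C [N [mC mN N0 AC CA]]] := completed_borel_approx mA.
have [D [M [mD mM M0 BD DB]]] := completed_borel_approx mB.
pose F k : set (borel T) := if k == i then C else D.
have FE : P ((X i @^-1` C) `&` (X j @^-1` D)) =
    (P (X i @^-1` C) * P (X j @^-1` D))%E.
  have mF k : measurable (F k) by rewrite /F; case: ifP.
  have := ind [fset i; j]%fset F mF.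
  rewrite big_fsetU1/= ?inE// big_seq_fset1 /F eqxx (eq_sym j i) (negbTE ij).
  move=> <-; congr (P _); apply/seteqP; split=> w /=.
    move=> [Cw Dw] k /=; rewrite !inE => /orP[] /eqP ->.
      by rewrite eqxx.
    by rewrite (eq_sym j i) (negbTE ij).
  move=> h; split.
    by have := h i; rewrite /= !inE eqxx => /(_ isT).
  by have := h j; rewrite /= !inE eqxx orbT (eq_sym j i) (negbTE ij) => /(_ isT).
have mX (k : nat) (E : set cT) : measurable E -> measurable (X k @^-1` E).
  by move=> mE; rewrite -[_ @^-1` _]setTI; exact: (completed_measurable (law k)).
have eqX k (E : set cT) (G L : set (borel T)) : measurable E -> measurable G ->
    measurable L -> distribution P xi L = 0%E -> E `<=` G `|` L ->
    G `<=` E `|` L -> P (X k @^-1` E) = P (X k @^-1` G).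
  move=> mE mG mL L0 EG GE.
  apply: (@measure_eq_mod_null _ _ _ P _ _ (X k @^-1` L)).
  - exact: mX.
  - exact: measurable_preimage_borel.
  - exact: measurable_preimage_borel.
  - exact: etrans (law k _ mL) L0.
  - by move=> w; exact: EG.
  - by move=> w; exact: GE.
rewrite (eqX i A C N)// (eqX j B D M)// -FE.
apply: (@measure_eq_mod_null _ _ _ P _ _ ((X i @^-1` N) `|` (X j @^-1` M))).
- by apply: measurableI; exact: mX.
- by apply: measurableI; exact: measurable_preimage_borel.
- by apply: measurableU; exact: measurable_preimage_borel.
- apply/eqP; rewrite eq_le measure_ge0 andbT.
  have mN' := measurable_preimage_borel (X i) mN.
  have mM' := measurable_preimage_borel (X j) mM.
  apply: le_trans (measureU2 P mN' mM') _.
  rewrite -[leRHS]adde0; apply: leeD; rewrite le_eqVlt; apply/orP; left; apply/eqP.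
    exact: etrans (law i _ mN) N0.
  exact: etrans (law j _ mM) M0.
- move=> w [/AC[Cw|Nw] /BD[Dw|Mw]]; [by left|by right; right|by right; left|by right; left].
- move=> w [/CA[Cw|Nw] /DB[Dw|Mw]]; [by left|by right; right|by right; left|by right; left].
Qed.

End completion.

(** * Weak-star convergence of sequences in the dual *)

Lemma near_inv_succ_lt (R : realType) (e : R) : 0 < e ->
  \forall n \near \oo, n.+1%:R^-1 < e.
Proof.
move=> e0; have := @cvg_harmonic R; move/cvgrPdist_lt => /(_ e e0).
by apply: filterS => n; rewrite sub0r normrN ger0_norm// /harmonic invr_ge0.
Qed.

Lemma inv_succ_lt (R : realType) (e : R) : 0 < e -> exists n : nat, n.+1%:R^-1 < e.
Proof. by move=> /near_inv_succ_lt/filter_ex. Qed.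

Lemma dense_sequence (T : ptopologicalType) : separable_space T ->
  exists d : nat -> T, forall O, open O -> O !=set0 -> exists n, O (d n).
Proof.
case=> S /countable_injP[f] finj dS.
pose d n : T := xget point (S `&` [set s | f s = n]).
exists d => O oO O0; have [s [Os Ss]] := dS O O0 oO.
exists (f s); suff -> : d (f s) = s by [].
have [Sd fd] : (S `&` [set t | f t = f s]) (d (f s)).
  by apply: (xgetPex point (P := S `&` [set t | f t = f s])); exists s.
by apply: finj => //; rewrite inE.
Qed.

Section weak_star_sequences.
Context (R : realType) (V : normedModType R).
Implicit Types (u : dual V).

Lemma dual_linear u : linear u.
Proof. by have /asboolP[] := dual_funP u. Qed.

Lemma dual_continuous u : continuous u.
Proof. by have /asboolP[] := dual_funP u. Qed.

Definition dual_linear_fun u : {linear V -> R^o} :=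
  HB.pack (u : V -> R^o) (GRing.isLinear.Build _ _ _ _ (u : V -> R^o) (@dual_linear u)).

Lemma dualZ u (a : R) v : u (a *: v) = a * u v.
Proof. exact: (linearZ_LR (dual_linear_fun u)). Qed.

Lemma dualB u v w : u (v - w) = u v - u w.
Proof. exact: (linearB (dual_linear_fun u)). Qed.

Lemma dual_boundedP u : exists2 C, 0 < C & forall v, `|u v| <= C * `|v|.
Proof.
have /linear_boundedP : bounded_near (dual_linear_fun u) (nbhs 0).
  by apply/linear_bounded_continuous; exact: dual_continuous.
by move=> /pinfty_ex_gt0[C C0 uC]; exists C.
Qed.

Lemma dual_norm_le u v : `|u v| <= dual_norm u * `|v|.
Proof.
have [C C0 uC] := dual_boundedP u.
have [->|v0] := eqVneq v 0.
  by rewrite -(scale0r (0 : V)) dualZ mul0r scale0r !normr0 mulr0.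
have nv0 : 0 < `|v| by rewrite normr_gt0.
rewrite -ler_pdivrMr//.
have -> : `|u v| / `|v| = `|u (`|v|^-1 *: v)|.
  by rewrite dualZ normrM normfV normr_id mulrC.
apply: ub_le_sup; last first.
  by exists (`|v|^-1 *: v) => //=; rewrite normrZ normfV normr_id mulVf// gt_eqF.
exists C => _ [w /= w1 <-]; apply: le_trans (uC w) _.
by rewrite ger_pMr.
Qed.

(** Cluster points in the topology of pointwise convergence are used only
through this property: they are approximated by late terms on any finite set. *)
Lemma ptws_cluster_approx (f_ : nat -> V -> R^o) (f : V -> R^o) :
  cluster ((f_ : nat -> {ptws V -> R^o}) @ \oo) (f : {ptws V -> R^o}) ->
  forall (N : nat) (s : seq V) (e : R), 0 < e ->
    exists2 n, (N <= n)%N & forall v, v \in s -> `|f_ n v - f v| < e.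
Proof.
move=> fc N s e e0.
have nB : nbhs (f : {ptws V -> R^o}) [set g | forall v, v \in s -> `|g v - f v| < e].
  elim: s => [|v s ih].
    by apply: (filterS _ (@filterT _ (nbhs (f : {ptws V -> R^o})) _)) => g _ w; rewrite in_nil.
  have fv : nbhs (f : {ptws V -> R^o}) [set g | ball (f v : R^o) e (g v)].
    exact: (@proj_continuous V (fun=> R^o) v f _ (nbhsx_ballx (f v : R^o) e e0)).
  apply: (@filterS2 _ _ (nbhs_filter (f : {ptws V -> R^o})) _ _ _ _ fv ih).
  move=> g gv gs w; rewrite in_cons => /predU1P[->|]; last exact: gs.
  by move: gv; rewrite /= -ball_normE/= distrC.
have nA : ((f_ : nat -> {ptws V -> R^o}) @ \oo) [set f_ n | n in [set n | (N <= n)%N]].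
  by exists N => // n /= Nn; exists n.
have [_ [[n Nn <-]] fn] := fc _ _ nA nB.
by exists n.
Qed.

Lemma weak_star_limit_point_ptws (u_ : nat -> dual V) u : weak_star_limit_point u_ u ->
  cluster ((fun n => u_ n : {ptws V -> R^o}) @ \oo) (u : {ptws V -> R^o}).
Proof.
move=> uc A B nA nB.
have nB' : nbhs (u : weak_star V) (dual_fun @^-1` B).
  exact: (@initial_continuous _ _ (dual_fun : dual V -> {ptws V -> R^o})).
have nA' : ((u_ : nat -> weak_star V) @ \oo) (dual_fun @^-1` A) by exact: nA.
by have [w [Aw Bw]] := uc _ _ nA' nB'; exists (dual_fun w).
Qed.

(** Pick the [N]-th term of the subsequence so that it approximates [u] on the
first [N] points of a dense sequence; equicontinuity propagates convergence from
the dense sequence to all of [V]. *)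
Lemma weak_star_subsequence (M : R) (u_ : nat -> dual V) u :
  separable_space V ->
  (forall n v, (0 < n)%N -> `|u_ n v| <= M * `|v|) ->
  cluster ((fun n => u_ n : {ptws V -> R^o}) @ \oo) (u : {ptws V -> R^o}) ->
  exists2 k : nat -> nat, (forall n, (n < k n)%N) & weak_star_cvg (u_ \o k) u.
Proof.
move=> V_separable uM /ptws_cluster_approx uc.
have [d dd] := dense_sequence V_separable.
have /choice[k kP] : forall N, exists n, (N < n)%N /\
    forall j, (j <= N)%N -> `|u_ n (d j) - u (d j)| < N.+1%:R^-1.
  move=> N; have [|n Nn un] := uc N.+1 [seq d j | j <- iota 0 N.+1] N.+1%:R^-1.
    by rewrite invr_gt0.
  exists n; split=> // j jN; apply: un; apply/mapP; exists j => //.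
  by rewrite mem_iota.
exists k; first by move=> n; case: (kP n).
apply/weak_star_cvgP => v.
have [C C0 uC] := dual_boundedP u.
apply/cvgrPdist_lt => e e0.
pose L := `|M| + C + 1.
have L0 : 0 < L by rewrite ltr_pwDr// addr_ge0// ltW.
have eL : 0 < e / 2 / L by rewrite !divr_gt0.
have [j vj] : exists j, ball v (e / 2 / L) (d j).
  by apply: dd; [exact: ball_open|exists v; exact: ballxx].
have [N _ hN] : \forall n \near \oo, n.+1%:R^-1 < e / 2.
  by apply: near_inv_succ_lt; rewrite divr_gt0.
exists (maxn N j) => // n /=; rewrite geq_max => /andP[Nn jn].
have [kn ukn] := kP n.
have {}ukn := lt_trans (ukn _ jn) (hN _ Nn).
have dv : `|v - d j| < e / 2 / L by move: vj; rewrite -ball_normE.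
have k0 : (0 < k n)%N by exact: leq_ltn_trans kn.
have h1 := uM (k n) (v - d j) k0.
have h2 := uC (v - d j).
rewrite /= distrC.
have -> : u_ (k n) v - u v = u_ (k n) (v - d j) - u (v - d j)
                            + (u_ (k n) (d j) - u (d j)).
  by rewrite !dualB; ring.
apply: le_lt_trans (ler_normD _ _) _.
apply: (@le_lt_trans _ _ (L * `|v - d j| + `|u_ (k n) (d j) - u (d j)|)).
  rewrite lerD2r; apply: le_trans (ler_normB _ _) _.
  apply: le_trans (lerD h1 h2) _; rewrite -mulrDl ler_wpM2r//.
  by rewrite /L; have := ler_norm M; lra.
have : L * `|v - d j| < e / 2.
  by move: dv; rewrite ltr_pdivlMr// mulrC.
lra.
Qed.

(** Banach-Alaoglu: a cluster point exists in the product of the segments by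
Tychonoff's theorem, and it inherits linearity and the bound. *)
Lemma bounded_ptws_cluster (M : R) (u_ : nat -> dual V) :
  (forall n v, (0 < n)%N -> `|u_ n v| <= M * `|v|) ->
  exists u, cluster ((fun n => u_ n : {ptws V -> R^o}) @ \oo) (u : {ptws V -> R^o}).
Proof.
move=> uM.
pose K (v : V) : set R^o := `[- (M * `|v|), M * `|v|]%classic.
have cK : compact [set f : {ptws V -> R^o} | forall v, K v (f v)].
  by apply: (tychonoff (T := fun _ : V => R^o)) => v; exact: segment_compact.
have FK : ((fun n => u_ n : {ptws V -> R^o}) @ \oo)
    [set f : {ptws V -> R^o} | forall v, K v (f v)].
  by exists 1%N => // n /= n0 v; rewrite /K /= in_itv/= -ler_norml uM.
have [f [Kf cf]] := cK _ _ FK.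
have fM v : `|f v| <= M * `|v| by have := Kf v; rewrite /K /= in_itv/= -ler_norml.
have lf : linear (f : V -> R^o).
  move=> a x y; apply/eqP; rewrite -subr_eq0 -normr_le0; apply/ler_addgt0Pl => e e0.
  pose L := `|a| + 2.
  have L0 : 0 < L by rewrite ltr_wpDl.
  have eL : 0 < e / L by rewrite divr_gt0.
  have [n _ fn] := ptws_cluster_approx cf 0 [:: a *: x + y; x; y] eL.
  have f1 := fn (a *: x + y); have f2 := fn x; have f3 := fn y.
  rewrite !inE !eqxx ?orbT in f1 f2 f3.
  have {}f1 := f1 isT; have {}f2 := f2 isT; have {}f3 := f3 isT.
  have un : u_ n (a *: x + y) = a * u_ n x + u_ n y by exact: dual_linear.
  have -> : f (a *: x + y) - (a *: f x + f y) =
    - (u_ n (a *: x + y) - f (a *: x + y)) + a * (u_ n x - f x) + (u_ n y - f y).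
    by rewrite un /GRing.scale/=; ring.
  rewrite addr0; apply: le_trans (ler_normD _ _) _.
  apply: (@le_trans _ _ (e / L + `|a| * (e / L) + e / L)).
    rewrite lerD ?(ltW f3)//; apply: le_trans (ler_normD _ _) _.
    by rewrite normrN normrM lerD ?ler_wpM2l// ltW.
  have -> : e / L + `|a| * (e / L) + e / L = e / L * L by rewrite /L; ring.
  by rewrite divfK// gt_eqF.
have cof : continuous (f : V -> R^o).
  pose lf' : {linear V -> R^o} := HB.pack (f : V -> R^o) (GRing.isLinear.Build _ _ _ _ (f : V -> R^o) lf).
  apply: (linear_bounded_continuous lf').1; apply/linear_boundedP.
  apply: filterS (nbhs_pinfty_ge (num_real M)) => r Mr x.
  by apply: le_trans (fM x) _; rewrite ler_wpM2r.
have fdual : (f : V -> R^o) \in @continuous_functional R V by apply/asboolP.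
by exists (Dual fdual).
Qed.

End weak_star_sequences.

(** * Infima of a random lower semicontinuous function over small balls *)

Section limn_einf_bounds.
Context (R : realType).
Implicit Types (v : nat -> \bar R) (c : \bar R).

Lemma limn_einf_le v c : (forall n, v n <= c)%E -> (limn_einf v <= c)%E.
Proof.
move=> vc; rewrite limn_einf_lim; apply: lime_le; first exact: is_cvg_einfs.
apply: nearW => n; apply: le_trans (vc n).
by apply: ereal_inf_lbound; exists n => /=.
Qed.

Lemma lt_limn_einf_near v c : (c < limn_einf v)%E -> \forall n \near \oo, (c < v n)%E.
Proof.
rewrite limn_einf_lim => cv.
have [n cn] : exists n, (c < einfs v n)%E.
  apply: contrapT => /forallNP h; move: cv; rewrite ltNge => /negP; apply.
  apply: lime_le; first exact: is_cvg_einfs.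
  by apply: nearW => n; rewrite leNgt; apply/negP/h.
exists n => // k /= nk; apply: lt_le_trans cn _.
by apply: ereal_inf_lbound; exists k.
Qed.

End limn_einf_bounds.

Section ball_infimum.
Context (R : realType) (W : normedModType R).
Context d' (T' : measurableType d') (J : W -> T' -> R).
Hypothesis J_ge0 : forall w x, 0 <= J w x.
Hypothesis J_lsc : random_lsc J.

Definition ball_inf (c : W) (r : R) (x : T') : R := inf [set J w x | w in ball c r].

Lemma ball_inf_le c r w x : ball c r w -> ball_inf c r x <= J w x.
Proof.
move=> cw; apply: ge_inf; last by exists w.
by exists 0 => _ [v _ <-].
Qed.

Lemma ball_inf_ge c r x t : 0 < r -> (forall w, ball c r w -> t <= J w x) ->
  t <= ball_inf c r x.
Proof.
move=> r0 tJ; apply: lb_le_inf; last by move=> _ [v cv <-]; exact: tJ.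
by exists (J c x); exists c => //; exact: ballxx.
Qed.

(** The infimum over the ball is below [t] exactly when the epigraph meets the
open cylinder over the ball and below [t], which is a measurable event for a
random closed set. *)
Lemma measurable_ball_inf c r : 0 < r -> measurable_fun setT (ball_inf c r).
Proof.
move=> r0; apply: (measurability (@RGenInftyO.G R)).
  exact: RGenInftyO.measurableE.
move=> _ [_ [t ->] <-]; rewrite setTI.
pose O : set (W * R^o) := (ball c r) `*` `]-oo, t[%classic.
have oO : open O.
  rewrite openE => -[w s] [/= cw st].
  exists (ball c r, `]-oo, t[%classic) => //=; split; apply: open_nbhs_nbhs; split=> //.
  exact: ball_open.
have := J_lsc.2 O oO.
congr (measurable _); apply/seteqP; split=> x /=.
  move=> [[w s] [/= Jws [/= cw]]]; rewrite !in_itv/= => st.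
  by apply: le_lt_trans st; apply: le_trans Jws; exact: ball_inf_le.
rewrite in_itv/= => hx.
have [_ [w cw <-] Jt] : exists2 s, [set J w x | w in ball c r] s & s < t.
  by apply: inf_lt hx; exists (J c x); exists c => //; exact: ballxx.
by exists (w, J w x); split; [rewrite /epigraph/=|split => //=; rewrite in_itv].
Qed.

(** A point strictly below the graph at [w] lies in the open complement of the
epigraph, so [J] stays above it on a neighbourhood of [w]. *)
Lemma ball_inf_cvg (c : nat -> W) (w : W) (x : T') :
  (forall j, ball (c j) j.+1%:R^-1 w) ->
  ball_inf (c j) j.+1%:R^-1 x @[j --> \oo] --> J w x.
Proof.
move=> cw; apply/cvgrPdist_lt => e e0.
have cE : closed (epigraph (J ^~ x)) := J_lsc.1 x.
have nE : (~` epigraph (J ^~ x)) (w, J w x - e / 2).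
  by rewrite /epigraph/= => h; lra.
have : nbhs ((w, J w x - e / 2) : W * R^o) (~` epigraph (J ^~ x)).
  by apply: open_nbhs_nbhs; split => //; exact: closed_openC.
move=> [[A B] /= [nA nB] AB].
have [r r0 rA] : exists2 r, 0 < r & ball w r `<=` A.
  by case/nbhs_ballP : nA => r r0 rA; exists r.
have [N _ hN] : \forall n \near \oo, n.+1%:R^-1 < r / 2.
  by apply: near_inv_succ_lt; rewrite divr_gt0.
exists N => // j /= /hN jr.
have lo : J w x - e / 2 <= ball_inf (c j) j.+1%:R^-1 x.
  apply: ball_inf_ge => // v cv.
  have Av : A v.
    apply: rA; rewrite [r]splitr; apply: (@ball_triangle _ _ (c j)).
      by apply: ball_sym; apply: le_ball (cw j); exact: ltW.
    by apply: le_ball cv; exact: ltW.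
  have : ~ (J v x <= J w x - e / 2).
    by apply: (AB (v, J w x - e / 2)); split => //=; exact: nbhs_singleton.
  by move/negP; rewrite -ltNge => /ltW.
have up := ball_inf_le x (cw j).
by rewrite ltr_norml; lra.
Qed.

Context (e : nat -> W).
Hypothesis e_dense : forall O, open O -> O !=set0 -> exists n, O (e n).

Lemma dense_centers w : exists k : nat -> nat, forall j, ball (e (k j)) j.+1%:R^-1 w.
Proof.
suff /choice[k kw] : forall j : nat, exists k, ball (e k) j.+1%:R^-1 w by exists k.
move=> j; have [||k ek] := e_dense (O := ball w (j.+1%:R^-1 : R)).
- exact: ball_open.
- by exists w; apply: ballxx; rewrite invr_gt0.
- by exists k; exact: ball_sym.
Qed.

Lemma measurable_normal_integrand w : measurable_fun setT (J w).
Proof.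
have [k kw] := dense_centers w.
apply: (measurable_fun_cvg (h := fun j => ball_inf (e (k j)) j.+1%:R^-1)).
  by move=> j; exact: measurable_ball_inf.
by move=> x _; exact: ball_inf_cvg.
Qed.

(** The truncation makes the sample means converge even where [J] has infinite
expectation. Using the same index [j] for the radius and the level is harmless, since both
limits are taken together. *)
Definition truncated_ball_inf (k j : nat) (x : T') : R :=
  Num.min (ball_inf (e k) j.+1%:R^-1 x) j%:R.

Lemma truncated_ball_inf_bounds k j x : 0 <= truncated_ball_inf k j x <= j%:R.
Proof.
by rewrite ge_min lexx orbT andbT le_min ler0n andbT ball_inf_ge.
Qed.

Lemma measurable_truncated_ball_inf k j :
  measurable_fun setT (truncated_ball_inf k j).
Proof. by apply: measurable_minr => //; exact: measurable_ball_inf. Qed.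

(** Fatou's lemma along balls shrinking to [w]. *)
Lemma integral_le_of_ball_inf d (Omega : measurableType d)
    (P : probability Omega R) (Z : {mfun Omega >-> T'}) (w : W) (c : \bar R) :
  (forall (k j : nat), ball (e k) j.+1%:R^-1 w ->
    (\int[P]_a (truncated_ball_inf k j (Z a))%:E <= c)%E) ->
  (\int[P]_a (J w (Z a))%:E <= c)%E.
Proof.
move=> hc; have [k kw] := dense_centers w.
pose f j a := (truncated_ball_inf (k j) j (Z a))%:E.
have ff a : f j a @[j --> \oo] --> (J w (Z a))%:E.
  apply: cvg_EFin; first exact: nearW.
  have := @ball_inf_cvg _ w (Z a) kw; apply: cvg_trans; apply: near_eq_cvg.
  exists (Num.truncn (J w (Z a))).+1 => // j /= hj; apply/esym; apply: min_l.
  apply: le_trans (ball_inf_le _ (kw j)) _.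
  by apply/ltW; apply: lt_le_trans (truncnS_gt _) _; rewrite ler_nat.
rewrite (eq_integral (fun a => limn_einf (f ^~ a))); last first.
  by move=> a _; have [-> _] := cvg_limn_einf_sup (ff a).
apply: le_trans (fatou _ _ _ _) _ => //.
- move=> j; apply/measurable_EFinP; apply: measurableT_comp => //.
  exact: measurable_truncated_ball_inf.
- by move=> j a _; rewrite lee_fin; case/andP: (truncated_ball_inf_bounds (k j) j (Z a)).
- by apply: limn_einf_le => j; exact: hc.
Qed.

End ball_infimum.

(** * Constraints that hold at all sample points *)

(** A subset of a separable metric space is separable: choose a point of [D] in
each ball of the countable base that meets [D]. *)
Lemma dense_sequence_in (R : realType) (W : normedModType R) (e : nat -> W)
    (D : set W) : (forall O, open O -> O !=set0 -> exists n, O (e n)) ->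
  D !=set0 -> exists2 q : nat -> W, (forall n, D (q n)) &
    forall w r, D w -> 0 < r -> exists n, ball w r (q n).
Proof.
move=> e_dense [w0 Dw0].
have /choice[p pP] : forall kj : nat * nat, exists w, D w /\
    ((exists v, D v /\ ball (e kj.1) (kj.2.+1%:R^-1 : R) v) ->
      ball (e kj.1) (kj.2.+1%:R^-1 : R) w).
  move=> [k j]; have [[v [Dv ev]]|h] := pselect (exists v, D v /\
    ball (e k) (j.+1%:R^-1 : R) v); first by exists v.
  by exists w0.
pose q (n : nat) : W := p (odflt (0, 0) (@choice.unpickle (nat * nat)%type n)).
exists q => [n|w r Dw r0]; first by case: (pP (odflt (0, 0) (@choice.unpickle (nat * nat)%type n))).
have [j jr] : exists j : nat, j.+1%:R^-1 < r / 2 by apply: inv_succ_lt; rewrite divr_gt0.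
have j0 : 0 < j.+1%:R^-1 :> R by rewrite invr_gt0.
have [||k ek] := e_dense (ball w (j.+1%:R^-1 : R)).
- exact: ball_open.
- by exists w; exact: ballxx.
have pe : ball (e k) (j.+1%:R^-1 : R) (p (k, j)).
  by apply: (pP (k, j)).2; exists w; split => //; exact: ball_sym.
exists (choice.pickle (k, j)); rewrite /q choice.pickleK /=.
by rewrite [r]splitr; apply: (@ball_triangle _ _ (e k)); apply: le_ball (ltW jr) _ _.
Qed.

Section constraint.
Context (R : realType) (W Y : normedModType R).
Context d' (T' : measurableType d') (D : set W) (GY : W -> T' -> Y) (K : set Y).
Hypothesis GY_caratheodory : caratheodory_on D GY.
Hypothesis K_closed : closed K.
Context (q : nat -> W).
Hypothesis q_in : forall n, D (q n).
Hypothesis q_dense : forall w (r : R), D w -> 0 < r -> exists n, ball w r (q n).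

Definition enlargement (m : nat) : set Y := \bigcup_(y in K) ball y (m.+1%:R^-1 : R).

(** The union ranges over the dense sequence [q] rather than over [D] to keep this
set measurable; continuity makes up for the difference. *)
Definition almost_feasible (k j m : nat) : set T' :=
  [set x | exists n, ball (q k) (j.+1%:R^-1 : R) (q n) /\ enlargement m (GY (q n) x)].

Lemma measurable_almost_feasible k j m : measurable (almost_feasible k j m).
Proof.
rewrite (_ : almost_feasible k j m =
  \bigcup_(n in [set n | ball (q k) (j.+1%:R^-1 : R) (q n)])
    (GY (q n) @^-1` enlargement m)); last first.
  by apply/seteqP; split=> x [n]; [move=> [? ?]; exists n|move=> ? ?; exists n].
apply: bigcup_measurable => n _.
rewrite -[_ @^-1` _]setTI; apply: (GY_caratheodory.2 _ (q_in n)) => //.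
apply: sub_sigma_algebra; apply: bigcup_open => y _; exact: ball_open.
Qed.

Lemma caratheodory_nbhs w x (O : set Y) : D w -> open O -> O (GY w x) ->
  exists2 r : R, 0 < r & forall v, D v -> ball w r v -> O (GY v x).
Proof.
move=> Dw oO Ow.
have := GY_caratheodory.1 x; move/subspace_continuousP => /(_ w Dw).
move=> /(_ O (open_nbhs_nbhs (conj oO Ow))).
rewrite /within/= => /nbhs_ballP[r r0 rO].
by exists r => // v Dv wv; exact: rO.
Qed.

Lemma feasible_almost_feasible k j m w x : D w -> ball (q k) (j.+1%:R^-1 : R) w ->
  K (GY w x) -> almost_feasible k j m x.
Proof.
move=> Dw kw Kw.
have oE : open (enlargement m) by apply: bigcup_open => y _; exact: ball_open.
have Ew : enlargement m (GY w x) by exists (GY w x) => //; apply: ballxx; rewrite invr_gt0.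
have [r r0 rE] := caratheodory_nbhs Dw oE Ew.
have : nbhs w (ball w r `&` ball (q k) (j.+1%:R^-1 : R)).
  apply: filterI; first exact: nbhsx_ballx.
  by apply: open_nbhs_nbhs; split => //; exact: ball_open.
move=> /nbhs_ballP[s s0 sB].
have [n wn] := q_dense Dw s0.
have [rn kn] := sB _ wn.
by exists n; split => //; exact: rE.
Qed.

Lemma almost_feasible_feasible w x : D w ->
  (forall k j m, ball (q k) (j.+1%:R^-1 : R) w -> almost_feasible k j m x) ->
  K (GY w x).
Proof.
move=> Dw h; apply: contrapT => nK.
have : nbhs (GY w x) (~` K).
  by apply: open_nbhs_nbhs; split => //; exact: closed_openC.
move=> /nbhs_ballP[s s0 sK].
have s2 : 0 < s / 2 by rewrite divr_gt0.
have [r r0 rG] := caratheodory_nbhs Dw (ball_open _ _) (ballxx (GY w x) s2).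
have [j jr] : exists j : nat, j.+1%:R^-1 < r / 2 by apply: inv_succ_lt; rewrite divr_gt0.
have [m ms] : exists m : nat, m.+1%:R^-1 < s / 2 by apply: inv_succ_lt.
have [k wk] : exists k, ball w (j.+1%:R^-1 : R) (q k).
  by apply: q_dense => //; rewrite invr_gt0.
have [n [kn [y Ky yn]]] := h k j m (ball_sym wk).
apply: (sK y) => //; rewrite [s]splitr; apply: (@ball_triangle _ _ (GY (q n) x)).
  apply: rG => //; rewrite [r]splitr; apply: (@ball_triangle _ _ (q k)).
    exact: le_ball (ltW jr) _ wk.
  exact: le_ball (ltW jr) _ kn.
by apply: ball_sym; exact: le_ball (ltW ms) _ yn.
Qed.

End constraint.

(** * Limits of sample-feasible points *)

(** A single outcome is fixed: [x] is the realized sample, and the hypotheses on it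
hold for almost every outcome. *)
Section consistency.
Context d (Omega : measurableType d) (R : realType) (P : probability Omega R).
Hypothesis P_complete : measure_is_complete P.
Context (Xi : completeMetricType R) (xi : {RV P >-> borel Xi}).
Local Notation T' := (completed_borel (distribution P xi)).
Context (V W Y Y0 : completeNormedModType R).
Context (iota : Y -> Y0) (B : dual V -> W).
Hypothesis iota_inj : injective iota.
Hypothesis B_continuous : weak_star_to_strong_seq_continuous B.
Context (J : W -> Xi -> R).
Hypothesis J_ge0 : forall w x, 0 <= J w x.
Local Notation Jc := (J : W -> T' -> R).
Hypothesis J_lsc : random_lsc Jc.
Context (psi : dual V -> \bar R).
Hypothesis psi_ge0 : forall u, (0 <= psi u)%E.
Hypothesis psi_lsc : weak_star_seq_lsc psi.
Hypothesis dom_closed : weak_star_seq_closed (effective_domain psi).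
Local Notation D := (B @` effective_domain psi).
Context (G : W -> Xi -> Y0) (GY : W -> T' -> Y) (K : set Y).
Hypothesis GYE : forall u x, iota (GY (B u) x) = G (B u) x.
Hypothesis GY_caratheodory : caratheodory_on D GY.
Hypothesis K_closed : closed K.
Context (e q : nat -> W).
Hypothesis e_dense : forall O, open O -> O !=set0 -> exists n, O (e n).
Hypothesis q_in : forall n, D (q n).
Hypothesis q_dense : forall w (r : R), D w -> 0 < r -> exists n, ball w r (q n).

Lemma image_feasibleE u x : (iota @` K) (G (B u) x) <-> K (GY (B u) x).
Proof.
rewrite -GYE; split=> [[y Ky /iota_inj <-]//|Ky].
by exists (GY (B u) x).
Qed.

Context (x : nat -> Xi) (a : nat -> nat -> R).
Hypothesis aE : forall k j,
  (\int[P]_w (truncated_ball_inf Jc e k j (xi w))%:E = (a k j)%:E)%E.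
Hypothesis mean_truncated_cvg : forall k j,
  n%:R^-1 * \sum_(i < n) truncated_ball_inf Jc e k j (x i) @[n --> \oo] --> a k j.
Hypothesis all_almost_feasible : forall k j m,
  (forall i, almost_feasible GY K q k j m (x i)) ->
  P (xi @^-1` almost_feasible GY K q k j m) = 1%E.

(** The index [N n] is the sample size of the problem for which [v n] is feasible
with value at most [c]. *)
Section limit.
Context (N : nat -> nat) (v : nat -> dual V) (u : dual V) (c : R).
Hypothesis N_gt : forall n, (n < N n)%N.
Hypothesis v_dom : forall n, effective_domain psi (v n).
Hypothesis v_feasible : forall n i, (i < N n)%N -> (iota @` K) (G (B (v n)) (x i)).
Hypothesis v_le : \forall n \near \oo,
  (((N n)%:R^-1 * \sum_(i < N n) J (B (v n)) (x i))%R%:E + psi (v n) <= c%:E)%E.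
Hypothesis vu : weak_star_cvg v u.

Lemma limit_dom : effective_domain psi u.
Proof. exact: dom_closed vu. Qed.

Lemma near_ball (w : W) r : ball w r (B u) -> \forall n \near \oo, ball w r (B (v n)).
Proof.
move=> wu; apply: (B_continuous vu).
by apply: open_nbhs_nbhs; split => //; exact: ball_open.
Qed.

Lemma limit_feasible : feasible iota K B G xi u.
Proof.
have Du : D (B u) by exists u => //; exact: limit_dom.
have H : {ae distribution P xi, forall y, forall k j m,
    ball (q k) (j.+1%:R^-1 : R) (B u) -> almost_feasible GY K q k j m y}.
  apply/ae_foralln => k; apply/ae_foralln => j; apply/ae_foralln => m.
  have [ku|nku] := pselect (ball (q k) (j.+1%:R^-1 : R) (B u)); last first.
    by apply: aeW => y.
  have mA := measurable_almost_feasible K GY_caratheodory q_in k j m.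
  have : P (xi @^-1` almost_feasible GY K q k j m) = 1%E.
    apply: all_almost_feasible => i.
    have [A _ hA] := near_ball ku.
    have iA : (i < N (maxn A i))%N.
      by apply: leq_ltn_trans (N_gt _); exact: leq_maxr.
    have DB : D (B (v (maxn A i))) by exists (v (maxn A i)).
    apply: (feasible_almost_feasible GY_caratheodory q_in q_dense m DB).
    - by apply: hA; exact: leq_maxl.
    - by apply/image_feasibleE; exact: v_feasible.
  move=> PA.
  have mZA : measurable (xi @^-1` almost_feasible GY K q k j m).
    rewrite -[_ @^-1` _]setTI.
    exact: (completed_measurable P_complete (fun _ _ => erefl)).
  have /(completed_null_negligible P_complete (measurableC mA)) :
      P (xi @^-1` (~` almost_feasible GY K q k j m)) = 0%E.
    rewrite preimage_setC; have := probability_setC P mZA; rewrite PA subee//.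
  by apply: negligibleS => y /= h AFy; apply: h.
apply: (negligibleS _ H) => y /= nK hy; apply: nK; apply/image_feasibleE.
exact: (almost_feasible_feasible GY_caratheodory K_closed q_in q_dense Du).
Qed.

Lemma limit_objective_le : (objective B J psi xi u <= c%:E)%E.
Proof.
have psi_fin : psi u \is a fin_num by rewrite ge0_fin_numE//; exact: limit_dom.
rewrite /objective -leeBrDr//.
rewrite unlock /=.
pose Z := completed_rv P_complete (X := xi) (fun _ _ => erefl).
rewrite -[in leRHS](fineK psi_fin) -EFinB.
have := @integral_le_of_ball_inf R W _ _ Jc J_ge0 J_lsc _ e_dense _ _ P Z (B u)
  (c - fine (psi u))%:E.
apply => k j ku.
rewrite [leLHS](aE k j) lee_fin leNgt; apply/negP => ca.
pose t := (a k j - (c - fine (psi u))) / 2.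
have t0 : 0 < t by rewrite divr_gt0// subr_gt0.
have h1 : \forall n \near \oo,
    a k j - t < (N n)%:R^-1 * \sum_(i < N n) truncated_ball_inf Jc e k j (x i).
  have := mean_truncated_cvg (k := k) (j := j).
  move/cvgrPdist_lt => /(_ _ t0)[A _ hA]; exists A => // n /= An.
  have := hA (N n) (leq_trans An (ltnW (N_gt n))).
  by rewrite ltr_norml => /andP[_]; lra.
have h2 : \forall n \near \oo, ((fine (psi u) - t)%:E < psi (v n))%E.
  apply: lt_limn_einf_near; apply: lt_le_trans (psi_lsc vu).
  by rewrite -{2}(fineK psi_fin) lte_fin; lra.
have h3 := near_ball ku.
have [n [[h1n h2n] [h3n vn]]] := filter_ex (filterI (filterI h1 h2) (filterI h3 v_le)).
move: vn; apply/negP; rewrite -ltNge.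
have -> : c%:E = ((a k j - t)%:E + (fine (psi u) - t)%:E)%E.
  by rewrite -EFinD; congr EFin; rewrite /t; lra.
apply: lteD => //; rewrite lte_fin; apply: lt_le_trans h1n _.
rewrite ler_wpM2l ?invr_ge0//; apply: ler_sum => i _.
rewrite /truncated_ball_inf ge_min; apply/orP; left.
exact: ball_inf_le.
Qed.

End limit.
End consistency.

(** * Convergence of optimal values and solutions *)

Section upper_bound.
Context d (Omega : measurableType d) (R : realType) (P : probability Omega R).
Hypothesis P_complete : measure_is_complete P.
Context (Xi : completeMetricType R) (xi : {RV P >-> borel Xi}).
Context (sample : nat -> {RV P >-> borel Xi}).
Hypothesis sample_indep : mutually_independent sample.
Hypothesis sample_law : forall (i : nat) (A : set (borel Xi)),
  measurable A -> distribution P (sample i) A = distribution P xi A.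
Local Notation T' := (completed_borel (distribution P xi)).
Context (V W Y Y0 : completeNormedModType R).
Context (iota : Y -> Y0) (B : dual V -> W).
Context (J : W -> Xi -> R).
Hypothesis J_ge0 : forall w x, 0 <= J w x.
Hypothesis mJ : forall w, measurable_fun setT (J w : T' -> R).
Context (psi : dual V -> \bar R).
Hypothesis psi_ge0 : forall u, (0 <= psi u)%E.
Context (G : W -> Xi -> Y0) (K : set Y).

Lemma objective_ge0 u : (0 <= objective B J psi xi u)%E.
Proof.
rewrite /objective adde_ge0// unlock.
by apply: integral_ge0 => w _; rewrite lee_fin.
Qed.

Lemma ae_saa_feasible u : feasible iota K B G xi u ->
  {ae P, forall omega, forall i, (iota @` K) (G (B u) (sample i omega))}.
Proof.
case=> N [mN N0 FN]; apply/ae_foralln => i; exists (sample i @^-1` N); split.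
- exact: measurable_preimage_borel.
- exact: etrans (sample_law i mN) N0.
- by move=> w; exact: FN.
Qed.

Lemma ae_saa_objective_le u : (objective B J psi xi u < +oo)%E ->
  {ae P, forall omega, forall c : R, (objective B J psi xi u < c%:E)%E ->
    \forall N \near \oo, (saa_objective B J psi sample N omega u <= c%:E)%E}.
Proof.
rewrite /objective => uoo.
have E0 : (0 <= 'E_P[(fun omega => J (B u) (xi omega))])%E.
  by rewrite unlock; apply: integral_ge0 => w _; rewrite lee_fin.
have Efin : ('E_P[(fun omega => J (B u) (xi omega))])%E \is a fin_num.
  by rewrite ge0_fin_numE//; apply: le_lt_trans uoo; rewrite leeDl.
have psifin : psi u \is a fin_num.
  by rewrite ge0_fin_numE//; apply: le_lt_trans uoo; rewrite leeDr.
pose m := fine ('E_P[(fun omega => J (B u) (xi omega))])%E.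
pose X i := completed_rv P_complete (sample_law i).
pose Z := completed_rv P_complete (X := xi) (fun _ _ => erefl).
have Em : (\int[P]_w (J (B u) (Z w))%:E = m%:E)%E by rewrite fineK//; rewrite unlock.
have lawX i (A : set T') : measurable A -> P (X i @^-1` A) = P (Z @^-1` A).
  exact: (completed_law P_complete (sample_law i)).
have indX i j (A C : set T') : i != j -> measurable A -> measurable C ->
    P ((X i @^-1` A) `&` (X j @^-1` C)) = (P (X i @^-1` A) * P (X j @^-1` C))%E.
  exact: (completed_independent P_complete sample_indep sample_law).
have := @strong_law _ _ _ _ _ P X Z lawX indX (J (B u)) m (mJ (B u)) (J_ge0 (B u)) Em.
apply: filterS => w wm c.
rewrite -(fineK Efin) -(fineK psifin) -EFinD lte_fin -/m => mc.
move/cvgrPdist_le : wm => /(_ (c - (m + fine (psi u)))).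
rewrite subr_gt0 => /(_ mc); apply: filterS => N hN.
rewrite /saa_objective -(fineK psifin) -EFinD lee_fin.
move: hN; rewrite ler_norml /sample_mean /X /=; lra.
Qed.

End upper_bound.

Theorem proposition3p1
  (R : realType)
  (d : measure_display) (Omega : measurableType d) (P : probability Omega R)
  (P_complete : measure_is_complete P)
  (Xi : completeMetricType R) (Xi_separable : separable_space Xi)
  (xi : {RV P >-> borel Xi}) (sample : nat -> {RV P >-> borel Xi})
  (sample_indep : mutually_independent sample)
  (sample_law : forall (i : nat) (A : set (borel Xi)),
    measurable A -> distribution P (sample i) A = distribution P xi A)
  (V W Y Y0 : completeNormedModType R)
  (V_separable : separable_space V) (W_separable : separable_space W)
  (Y_separable : separable_space Y) (Y0_separable : separable_space Y0)
  (iota : {linear Y -> Y0}) (iota_inj : injective iota)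
  (B : {linear dual V -> W})
  (B_continuous : weak_star_to_strong_seq_continuous B)
  (J : W -> Xi -> R) (J_ge0 : forall w x, 0 <= J w x)
  (J_lsc : random_lsc (J : W -> completed_borel (distribution P xi) -> R))
  (psi : dual V -> \bar R) (psi_ge0 : forall u, (0 <= psi u)%E)
  (psi_proper : proper_function psi) (psi_convex : convex_efunction psi)
  (psi_lsc : weak_star_seq_lsc psi)
  (dom_bounded : dual_bounded (effective_domain psi))
  (dom_closed : weak_star_seq_closed (effective_domain psi))
  (G : W -> Xi -> Y0)
  (G_caratheodory :
    caratheodory_on setT (G : W -> completed_borel (distribution P xi) -> Y0))
  (G_range : forall u x, range iota (G (B u) x))
  (G_caratheodory_Y : exists2 GY : W -> completed_borel (distribution P xi) -> Y,
    (forall u x, iota (GY (B u) x) = G (B u) x) &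
    caratheodory_on (B @` effective_domain psi) GY)
  (K : set Y) (K_nonempty : K !=set0) (K_closed : closed K)
  (K_convex : convex_set (K : set (convex_lmodType Y))) (K_cone : is_cone K)
  (feasible_point : exists2 u, feasible iota K B G xi u &
    (objective B J psi xi u < +oo)%E)
  (u_ : nat -> Omega -> dual V)
  (u_solves : {ae P, forall omega, forall N : nat, (0 < N)%N ->
    solves (saa_feasible iota K B G sample N omega)
           (saa_objective B J psi sample N omega) (u_ N omega)}) :
  {ae P, forall omega,
    optimal_value (saa_feasible iota K B G sample N omega)
                  (saa_objective B J psi sample N omega) @[N --> \oo]
      --> optimal_value (feasible iota K B G xi) (objective B J psi xi) /\
    forall u : dual V, weak_star_limit_point (fun N => u_ N omega) u ->
      solves (feasible iota K B G xi) (objective B J psi xi) u}.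
Proof.
have [e e_dense] := dense_sequence W_separable.
have [GY GYE GY_car] := G_caratheodory_Y.
have D0 : (B @` effective_domain psi) !=set0.
  by case: psi_proper => _ [u0 Du0]; exists (B u0); exists u0.
have [q q_in q_dense] := dense_sequence_in e_dense D0.
have [M0 domM] := dom_bounded.
pose Jc : W -> completed_borel (distribution P xi) -> R := J.
pose X i := completed_rv P_complete (sample_law i).
pose Z := completed_rv P_complete (X := xi) (fun _ _ => erefl).
have lawX i (A : set (completed_borel (distribution P xi))) : measurable A ->
    P (X i @^-1` A) = P (Z @^-1` A).
  exact: (completed_law P_complete (sample_law i)).
have indX i j (A C : set (completed_borel (distribution P xi))) : i != j ->
    measurable A -> measurable C ->
    P ((X i @^-1` A) `&` (X j @^-1` C)) = (P (X i @^-1` A) * P (X j @^-1` C))%E.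
  exact: (completed_independent P_complete sample_indep sample_law).
have mJ w : measurable_fun setT (Jc w).
  exact: (@measurable_normal_integrand R W _ _ Jc J_ge0 J_lsc e e_dense w).
have trunc0 k j y : 0 <= truncated_ball_inf Jc e k j y <= j%:R.
  exact: (@truncated_ball_inf_bounds R W _ _ Jc J_ge0).
have mtrunc k j : measurable_fun setT (truncated_ball_inf Jc e k j).
  exact: (@measurable_truncated_ball_inf R W _ _ Jc J_ge0 J_lsc).
have /choice[a' a'E] : forall kj : nat * nat, exists a,
    (\int[P]_w (truncated_ball_inf Jc e kj.1 kj.2 (Z w))%:E = a%:E)%E.
  move=> [k j]; have [a _ aE] := bounded_mean P Z (mtrunc k j) (trunc0 k j).
  by exists a.
pose a k j := a' (k, j).
have good1 : {ae P, forall w, forall k j,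
    sample_mean X (truncated_ball_inf Jc e k j) n w @[n --> \oo] --> a k j}.
  apply/ae_foralln => k; apply/ae_foralln => j.
  exact: (strong_law_bounded lawX indX (mtrunc k j) (trunc0 k j) (a'E (k, j))).
have good2 : {ae P, forall w, forall k j m,
    (forall i, almost_feasible GY K q k j m (X i w)) ->
    P (Z @^-1` almost_feasible GY K q k j m) = 1%E}.
  apply/ae_foralln => k; apply/ae_foralln => j; apply/ae_foralln => m.
  exact: (ae_all_samples_in lawX indX (measurable_almost_feasible K GY_car q_in k j m)).
have [uf uf_feas uf_obj] := feasible_point.
set feas := feasible iota K B G xi; set obj := objective B J psi xi.
have opt_fin : optimal_value feas obj \is a fin_num.
  rewrite ge0_fin_numE.
    by apply: le_lt_trans uf_obj; apply: ereal_inf_lbound; exists uf.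
  by apply/ereal_infP => _ [v _ <-]; exact: objective_ge0.
pose t := fine (optimal_value feas obj).
have tE : optimal_value feas obj = t%:E by rewrite fineK.
have obj_ge v : feas v -> (t%:E <= obj v)%E.
  by move=> fv; rewrite -tE; apply: ereal_inf_lbound; exists v.
(* Countably many feasible points suffice to approach the optimal value, so a
   single null set covers all of them. *)
have /choice[v_ v_P] : forall l : nat, exists v, feas v /\ (obj v < (t + l.+1%:R^-1)%:E)%E.
  move=> l; have l0 : 0 < l.+1%:R^-1 :> R by rewrite invr_gt0.
  have [_ [v fv <-] vl] := lb_ereal_inf_adherent l0 opt_fin.
  by exists v; split => //; rewrite EFinD -tE.
have good3 : {ae P, forall w, forall l,
    (forall i, (iota @` K) (G (B (v_ l)) (sample i w))) /\
    forall c : R, (obj (v_ l) < c%:E)%E ->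
    \forall N \near \oo, (saa_objective B J psi sample N w (v_ l) <= c%:E)%E}.
  apply/ae_foralln => l; have [fl ol] := v_P l.
  have loo : (obj (v_ l) < +oo)%E by apply: lt_trans ol _; rewrite ltry.
  have h1 := ae_saa_feasible sample_law fl.
  have h2 := ae_saa_objective_le P_complete sample_indep sample_law J_ge0 mJ psi_ge0 loo.
  by apply: filterS2 h1 h2.
have FP : Filter (almost_everywhere P) by exact: ae_filter_ringOfSetsType.
apply: (@filterS2 _ _ FP _ _ _ _ (@filterI _ _ FP _ _ good1 good2)
  (@filterI _ _ FP _ _ good3 u_solves)).
move=> w [w1 w2] [w3 w4].
set opt := fun N => optimal_value _ _.
have optE N : (0 < N)%N -> opt N = saa_objective B J psi sample N w (u_ N w).
  move=> N0; have [fN mN] := w4 N N0; apply/eqP; rewrite eq_le; apply/andP; split.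
    by apply: ereal_inf_lbound; exists (u_ N w).
  by apply/ereal_infP => _ [v fv <-]; exact: mN.
have opt_le l N : (opt N <= saa_objective B J psi sample N w (v_ l))%E.
  apply: ereal_inf_lbound; exists (v_ l) => // i _.
  by have [] := w3 l.
have upper c : t < c -> \forall N \near \oo, (opt N <= c%:E)%E.
  move=> tc; have [l lc] : exists l : nat, l.+1%:R^-1 < c - t.
    by apply: inv_succ_lt; rewrite subr_gt0.
  have [_ /(_ c)] := w3 l; have [_ ol] := v_P l.
  have olc : (obj (v_ l) < c%:E)%E.
    by apply: lt_trans ol _; rewrite lte_fin -ltrBrDl.
  by move=> /(_ olc); apply: filterS => N; apply: le_trans.
have saa_ge0 N v : (0%:E <= (N%:R^-1 * \sum_(i < N) J (B v) (sample i w))%:E)%E.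
  by rewrite lee_fin mulr_ge0 ?invr_ge0// sumr_ge0.
have u_dom N : (0 < N)%N -> effective_domain psi (u_ N w).
  move=> N0; rewrite /effective_domain /=.
  apply: (@le_lt_trans _ _ (opt N)); first by rewrite optE// leeDr.
  apply: le_lt_trans (opt_le 0%N N) _.
  apply: lte_add_pinfty; first by rewrite ltry.
  have [_ o0] := v_P 0%N; apply: (@le_lt_trans _ _ (obj (v_ 0%N))).
    rewrite /obj /objective leeDr// unlock.
    by apply: integral_ge0 => y _; rewrite lee_fin.
  by apply: lt_trans o0 _; rewrite ltry.
have u_bound N v : (0 < N)%N -> `|u_ N w v| <= M0 * `|v|.
  move=> N0; apply: le_trans (dual_norm_le _ _) _.
  by rewrite ler_wpM2r//; apply: domM; exact: u_dom.
(* Both the lower bound and the optimality of limit points come from this. *)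
have key (N : nat -> nat) u c : (forall n, (n < N n)%N) ->
    weak_star_cvg (fun n => u_ (N n) w) u ->
    (\forall n \near \oo, (opt (N n) <= c%:E)%E) -> feas u /\ (obj u <= c%:E)%E.
  move=> nN Nu Nc.
  have N0 n : (0 < N n)%N by exact: leq_ltn_trans (nN n).
  have d_ n : effective_domain psi (u_ (N n) w) by exact: u_dom.
  have f_ n i : (i < N n)%N -> (iota @` K) (G (B (u_ (N n) w)) (sample i w)).
    by have [fN _] := w4 _ (N0 n); exact: fN.
  split.
    exact: (@limit_feasible _ _ _ P P_complete _ xi _ _ _ _ _ B iota_inj B_continuous
      psi dom_closed G GY K GYE GY_car K_closed q q_in q_dense (fun i => sample i w)
      w2 N (fun n => u_ (N n) w) u nN d_ f_ Nu).
  apply: (@limit_objective_le _ _ _ P P_complete _ xi _ _ B B_continuous J J_ge0 J_lsc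
    psi psi_ge0 psi_lsc dom_closed e e_dense (fun i => sample i w) a
    (fun k j => a'E (k, j)) w1 N (fun n => u_ (N n) w) u c nN d_ _ Nu).
  by apply: filterS Nc => n; rewrite optE.
have lower c : c < t -> \forall N \near \oo, (c%:E <= opt N)%E.
  move=> ct; apply: contrapT => nh.
  have /choice[N NP] : forall n, exists N, (n < N)%N /\ (opt N < c%:E)%E.
    move=> n; apply: contrapT => hn; apply: nh; exists n.+1 => // N /= nN.
    by rewrite leNgt; apply/negP => Nc; apply: hn; exists N.
  have nN n : (n < N n)%N by case: (NP n).
  have b_ n v : (0 < n)%N -> `|u_ (N n) w v| <= M0 * `|v|.
    by move=> n0; apply: u_bound; exact: leq_ltn_trans (nN n).
  have [u uc] := bounded_ptws_cluster b_.
  have [k kn ku] := weak_star_subsequence V_separable b_ uc.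
  have [||fu ou] := key (N \o k) u c _ ku.
  - by move=> n; apply: ltn_trans (kn n) (nN _).
  - by apply: nearW => n /=; case: (NP (k n)) => _ /ltW.
  by have := le_trans (obj_ge u fu) ou; rewrite lee_fin leNgt ct.
split.
  rewrite tE; apply/fine_cvgP; split.
    have t1 : t < t + 1 by rewrite ltrDl.
    have t2 : t - 1 < t by rewrite ltrBlDr ltrDl.
    apply: filterS2 (upper _ t1) (lower _ t2) => N h1 h2.
    by rewrite fin_numE; apply/andP; split; apply/eqP => h; move: h1 h2; rewrite h.
  apply/cvgrPdist_le => eps eps0.
  have t1 : t < t + eps by rewrite ltrDl.
  have t2 : t - eps < t by rewrite ltrBlDr ltrDl.
  apply: filterS2 (upper _ t1) (lower _ t2) => N /=.
  case: (opt N) => [r| |] //=; rewrite !lee_fin => h1 h2.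
  by rewrite ler_norml; lra.
move=> u /weak_star_limit_point_ptws uc.
have [k kn ku] := weak_star_subsequence V_separable u_bound uc.
have fo c : t < c -> feas u /\ (obj u <= c%:E)%E.
  move=> tc; apply: (key k) => //.
  have [A _ hA] := upper c tc; exists A => // n /= An; apply: hA => /=.
  exact: leq_trans An (ltnW (kn n)).
have t1 : t < t + 1 by rewrite ltrDl.
split; first by case: (fo _ t1).
move=> v fv; apply: le_trans (obj_ge v fv).
apply/lee_addgt0Pr => eps eps0; rewrite -EFinD.
by have [] := fo (t + eps); rewrite ?ltrDl.
Qed.
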